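(* Let $d\ge2$, $c>0$, and let $k^{\mathrm{Lap}}(\mathbf{x},\mathbf{z})=e^{-c\sqrt{1-\mathbf{x}^T\mathbf{z}}}$ for $\mathbf{x},\mathbf{z}\in\mathbb{S}^{d-1}$ (the Laplace kernel restricted to the sphere). Then $k^{\mathrm{Lap}}(\mathbf{x},\mathbf{z})=\sum_{k\ge0}\lambda_k\sum_{j=1}^{N(d,k)}Y_{k,j}(\mathbf{x})Y_{k,j}(\mathbf{z})$ with $\lambda_k>0$ for all $k\ge0$, and there exist $k_0$ and constants $B_1,B_2>0$ depending on $d$ and $c$ such that for all $k>k_0$, $B_1k^{-d}\le\lambda_k\le B_2k^{-d}$.
   Context: $\{Y_{k,j}\}_{j=1}^{N(d,k)}$ is an orthonormal basis (in $L^2$ of the uniform surface measure on $\mathbb{S}^{d-1}$) of the space of spherical harmonics of degree $k$; the $\lambda_k$ are the Mercer eigenvalues of the zonal kernel with respect to the uniform measure on $\mathbb{S}^{d-1}$. *)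

(* Defs.v *)
From HB Require Import structures.
From mathcomp Require Import all_boot all_order all_algebra.
From mathcomp Require Import mpoly.
From mathcomp Require Import all_classical all_reals all_analysis.
Set Implicit Arguments. Unset Strict Implicit. Unset Printing Implicit Defensive.
Import Order.TTheory GRing.Theory Num.Theory.
Import numFieldNormedType.Exports.
Local Open Scope classical_set_scope.
Local Open Scope ring_scope.

Definition dotp (R : realType) (n : nat) (x z : 'rV[R]_n) : R :=
  \sum_(i < n) x 0 i * z 0 i.

Definition on_sphere (R : realType) (n : nat) (x : 'rV[R]_n) : Prop :=
  dotp x x = 1.

(* Integral over R^n w.r.t. n-dimensional Lebesgue measure, as the iterated
   one-dimensional Lebesgue integral (Fubini). *)
Fixpoint iint (R : realType) (n : nat) : ('rV[R]_n -> R) -> R :=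
  match n with
  | 0 => fun f => f 0
  | n'.+1 => fun f =>
      Rintegral (@lebesgue_measure R) setT
        (fun t : R => @iint R n' (fun v : 'rV[R]_n' => f (row_mx (t%:M) v)))
  end.

(* Integral over S^{n-1} w.r.t. the (unnormalized) uniform surface measure,
   via the polar-coordinate identity
     int_{S^{n-1}} g dsigma = n * int_{0 < |x| <= 1} g(x/|x|) dx. *)
Definition sint (R : realType) (n : nat) (g : 'rV[R]_n -> R) : R :=
  n%:R * iint (fun x : 'rV[R]_n =>
    if (0 < dotp x x) && (dotp x x <= 1)
    then g ((Num.sqrt (dotp x x))^-1 *: x) else 0).

Definition klap (R : realType) (n : nat) (c : R) (x z : 'rV[R]_n) : R :=
  expR (- (c * Num.sqrt (1 - dotp x z))).

Definition peval (R : realType) (n : nat) (p : mpoly.mpoly n R) (x : 'rV[R]_n) : R :=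
  mpoly.meval (fun i => x 0 i) p.

Definition laplacian (R : realType) (n : nat) (p : mpoly.mpoly n R) : mpoly.mpoly n R :=
  \sum_(i < n) mpoly.mderiv i (mpoly.mderiv i p).

(* p is a homogeneous harmonic polynomial of degree k; the spherical harmonics
   of degree k are exactly the restrictions of such p to the sphere *)
Definition harm_homog (R : realType) (n k : nat) (p : mpoly.mpoly n R) : Prop :=
  all [pred m | mpoly.mdeg m == k] (mpoly.msupp p) /\ laplacian p = (0 : mpoly.mpoly n R).

Definition sh_onb (R : realType) (n k N : nat) (Y : 'I_N -> mpoly.mpoly n R) : Prop :=
  (forall j, harm_homog k (Y j)) /\
  (forall j j', sint (fun x => peval (Y j) x * peval (Y j') x) = (j == j')%:R) /\
  (forall p, harm_homog k p -> exists a : 'I_N -> R,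
     forall x, on_sphere x -> peval p x = \sum_(j < N) a j * peval (Y j) x).

(* Main.v *)
(* The profile expR (- c * sqrt (1 - t)) has a power series sum a_n t^n with
   positive coefficients, summable on [-1, 1], and comparable (n >= 1) with the
   coefficients of - sqrt (1 - t).

   The sphere integral is rotation invariant, so it kills the infinitesimal
   rotations x_i d_j - x_j d_i; since the sum of their squares is the spherical
   Laplacian, integrating the Laplacian of a homogeneous polynomial of degree m
   multiplies its integral by m (m + d - 2). Applied to (x . z)^n p(z) with p
   harmonic of degree k this gives the eigenvalue beta(n, k) >= 0 of the kernel
   (x . z)^n in closed form, and lam_k = sum_n a_n beta(n, k) > 0.

   For - sqrt (1 - t) in place of the profile, the relations between
   beta(n, k) and beta(n + 1, k +- 1) give a first-order recurrence in k, solved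
   by C / prod_(j < d) (k - 1/2 + j); comparing coefficients yields the rate
   k^-d.

   Decomposing (x . z)^n into harmonics gives
   (x . z)^n = sum_(k <= n) beta(n, k) Z_k(x, z) with Z_k the reproducing
   kernels. Its partial sums are bounded by 1 by Cauchy-Schwarz, so summing
   against a_n and dominated convergence give the Mercer expansion. *)
Require Import Defs.
From HB Require Import structures.
From mathcomp Require Import all_boot all_order all_algebra.
From mathcomp Require Import mpoly.
From mathcomp Require Import all_classical all_reals all_analysis.
From mathcomp Require Import measurable_realfun.
From mathcomp Require Import ring lra.
Import Order.TTheory GRing.Theory Num.Theory.
Import numFieldNormedType.Exports.
Local Open Scope classical_set_scope.
Local Open Scope ring_scope.
Set Implicit Arguments.
Unset Strict Implicit.
Unset Printing Implicit Defensive.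

(** The profile satisfies a second-order equation, so its coefficients obey a three-term recurrence.
    Dropping the [c ^ 2 / 4] term leaves the two-term recurrence of [- sqrt (1 - t)], whose
    eigenvalues are explicit; since every beta(n, k) is nonnegative, a two-sided comparison of
    coefficients passes to the eigenvalues term by term. Summability at t = 1 provides one tail,
    [lap_sum c - \sum_(n < N) lap_coef c n], which controls every limit uniformly on [-1, 1],
    although the profile is not differentiable at t = 1.

    The sphere integral is an iterated integral over a ball. Fubini in the plane reaches only the
    rotations of two consecutive coordinates; commutators of infinitesimal rotations give the other
    pairs. The total mass of the sphere is never computed: it enters as a positive scalar [w]. *)

(** * Taylor coefficients of the profile and of [- sqrt (1 - t)] *)

Section Coefficients.
Variable R : realType.
Implicit Types (c w : R) (n k m d N : nat).

(* Taylor coefficients at 0 of [K t = expR (- c * sqrt (1 - t))]: the recurrence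
   expresses [(1 - t) K'' = K' / 2 + c ^ 2 / 4 * K]. *)
Fixpoint lap_coef_pair c n : R * R :=
  if n is m.+1 then
    let p := lap_coef_pair c m in
    (p.2, (m.+1%:R * (m%:R + 2^-1) * p.2 + c ^+ 2 / 4 * p.1) / (m.+2%:R * m.+1%:R))
  else (expR (- c), c / 2 * expR (- c)).

Definition lap_coef c n := (lap_coef_pair c n).1.

Lemma lap_coef0 c : lap_coef c 0 = expR (- c). Proof. by []. Qed.

Lemma lap_coef1 c : lap_coef c 1 = c / 2 * expR (- c). Proof. by []. Qed.

Lemma lap_coefSS c n : lap_coef c n.+2 =
  (n.+1%:R * (n%:R + 2^-1) * lap_coef c n.+1 + c ^+ 2 / 4 * lap_coef c n)
  / (n.+2%:R * n.+1%:R).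
Proof. by []. Qed.

Lemma lap_coef_gt0 c n : 0 < c -> 0 < lap_coef c n.
Proof.
move=> c0; suff: 0 < lap_coef c n /\ 0 < lap_coef c n.+1 by case.
elim: n => [|n [IH1 IH2]].
  by rewrite lap_coef0 lap_coef1 expR_gt0 mulr_gt0 ?expR_gt0 ?divr_gt0.
split => //; rewrite lap_coefSS divr_gt0 ?mulr_gt0 //.
by apply: addr_gt0; rewrite ?mulr_gt0 ?exprn_gt0 ?ltr_wpDl ?invr_gt0.
Qed.

(* [sqrt_coef n] is the coefficient of [t ^ n.+1] in [- sqrt (1 - t)]. *)
Fixpoint sqrt_coef n : R :=
  if n is m.+1 then (m%:R + 2^-1) / m.+2%:R * sqrt_coef m else 2^-1.

Lemma sqrt_coefS n : sqrt_coef n.+1 = (n%:R + 2^-1) / n.+2%:R * sqrt_coef n.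
Proof. by []. Qed.

Lemma sqrt_coefSM n : n.+2%:R * sqrt_coef n.+1 = (n%:R + 2^-1) * sqrt_coef n.
Proof. by rewrite sqrt_coefS mulrA [n.+2%:R * _]mulrC mulfVK. Qed.

Arguments sqrt_coef : simpl never.

Lemma sqrt_coef0 : sqrt_coef 0 = 2^-1. Proof. by []. Qed.

Lemma sqrt_coef_gt0 n : 0 < sqrt_coef n.
Proof.
elim: n => [|n IH]; first by rewrite sqrt_coef0 invr_gt0.
by rewrite sqrt_coefS mulr_gt0// divr_gt0// ltr_wpDl// invr_gt0.
Qed.

(** Dropping the nonnegative [c ^+ 2 / 4] term of the recurrence leaves exactly the ratio of
    consecutive [sqrt_coef]. *)
Lemma lap_coefSS_ge c n : 0 < c ->
  (n%:R + 2^-1) / n.+2%:R * lap_coef c n.+1 <= lap_coef c n.+2.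
Proof.
move=> c0; rewrite lap_coefSS [leRHS]mulrDl.
rewrite [X in _ <= X + _](_ : _ = (n%:R + 2^-1) / n.+2%:R * lap_coef c n.+1).
  by rewrite lerDl divr_ge0 ?mulr_ge0 ?ltW ?lap_coef_gt0 ?exprn_gt0.
by have n0 := ler0n R n; field; rewrite !gt_eqF//; lra.
Qed.

(** The constant makes the two sides equal at [n = 0]; the ratio bound propagates the inequality. *)
Lemma sqrt_coef_le_lap c n : 0 < c ->
  c * expR (- c) * sqrt_coef n <= lap_coef c n.+1.
Proof.
move=> c0; elim: n => [|n IH]; first by rewrite lap_coef1 sqrt_coef0 mulrAC.
apply: le_trans (lap_coefSS_ge n c0); rewrite sqrt_coefS mulrCA ler_wpM2l//.
Qed.

(** This makes the correction factors in the next lemma multiply to a bounded product. *)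
Lemma half_inv_telescope n :
  ((n%:R + 2^-1) * (n.+1%:R + 2^-1))^-1 =
  (n%:R + 2^-1)^-1 - (n.+1%:R + 2^-1)^-1 :> R.
Proof.
have n0 := ler0n R n; rewrite -[n.+1%:R]natr1; move: (n%:R) n0 => x x0.
by field; rewrite !gt_eqF//; lra.
Qed.

(** Compared with [sqrt_coef], each ratio gains at most the factor
    [1 + rho / ((n + 1/2) (n + 3/2))], which is below the exponential of a telescoping term. The
    accumulated factor stays under [expR (rho * 2)]. *)
Lemma lap_coef_le_sqrt c : 0 < c -> exists2 C : R, 0 < C &
  forall n, lap_coef c n.+1 <= C * sqrt_coef n.
Proof.
move=> c0; pose rho := c ^+ 2 / 4; pose D := lap_coef c 2 / sqrt_coef 1.
have rho0 : 0 <= rho by rewrite divr_ge0 ?exprn_ge0 ?ltW.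
have D0 : 0 < D by rewrite divr_gt0 ?lap_coef_gt0 ?sqrt_coef_gt0.
have hpos m : 0 < m%:R + 2^-1 :> R by rewrite ltr_wpDl// invr_gt0.
(* The exponent is the telescoped sum of the corrections up to [n]; it vanishes at [n = 0] because
   the inverse of 1/2 is 2. *)
have claim n : lap_coef c n.+2 <=
    D * expR (rho * (2 - (n%:R + 2^-1)^-1)) * sqrt_coef n.+1.
  elim: n => [|n IH].
    rewrite add0r invrK subrr mulr0 expR0 mulr1 divfK//.
    by rewrite gt_eqF// sqrt_coef_gt0.
  (* The lower ratio bound, inverted, turns the three-term recurrence into a one-step inequality. *)
  have aS : lap_coef c n.+1 <= n.+2%:R / (n%:R + 2^-1) * lap_coef c n.+2.
    have := lap_coefSS_ge n c0.
    rewrite mulrAC ler_pdivrMr// mulrC => H.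
    by rewrite mulrAC ler_pdivlMr// [_ * lap_coef _ _]mulrC.
  have step : lap_coef c n.+3 <= (n.+1%:R + 2^-1) / n.+3%:R *
       (1 + rho / ((n%:R + 2^-1) * (n.+1%:R + 2^-1))) * lap_coef c n.+2.
    apply: (@le_trans _ _ ((n.+2%:R * (n.+1%:R + 2^-1) * lap_coef c n.+2 +
        rho * (n.+2%:R / (n%:R + 2^-1) * lap_coef c n.+2)) / (n.+3%:R * n.+2%:R))).
      rewrite lap_coefSS -/rho ler_wpM2r ?invr_ge0 ?mulr_ge0//.
      by rewrite lerD2l ler_wpM2l.
    rewrite le_eqVlt; apply/orP; left; apply/eqP.
    have n0 := ler0n R n; rewrite -[n.+3%:R]natr1 -[n.+2%:R]natr1 -[n.+1%:R]natr1.
    move: (n%:R) n0 => x x0; field.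
    by rewrite !gt_eqF//; lra.
  apply: le_trans step _.
  apply: (@le_trans _ _ ((n.+1%:R + 2^-1) / n.+3%:R *
     expR (rho / ((n%:R + 2^-1) * (n.+1%:R + 2^-1))) *
     (D * expR (rho * (2 - (n%:R + 2^-1)^-1)) * sqrt_coef n.+1))).
    apply: ler_pM => //; first 2 last.
    - by rewrite ler_wpM2l ?expR_ge1Dx// divr_ge0// ltW.
    - by rewrite mulr_ge0 ?divr_ge0 ?addr_ge0 ?mulr_ge0 ?divr_ge0 ?mulr_ge0// ltW.
    - by rewrite ltW// lap_coef_gt0.
  rewrite [sqrt_coef n.+2]sqrt_coefS half_inv_telescope.
  rewrite [X in _ <= D * X * _](_ : _ = expR (rho * ((n%:R + 2^-1)^-1 - (n.+1%:R + 2^-1)^-1)) *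
    expR (rho * (2 - (n%:R + 2^-1)^-1))).
    by rewrite le_eqVlt; apply/orP; left; apply/eqP; ring.
  by rewrite -expRD; congr expR; ring.
(* The second summand covers the coefficient of [t], which [claim] leaves out. *)
exists (D * expR (rho * 2) + c * expR (- c)).
  by apply: addr_gt0; apply: mulr_gt0; rewrite ?expR_gt0.
case=> [|n].
  rewrite lap_coef1 sqrt_coef0 mulrDl -[X in X <= _]add0r lerD//.
    apply: mulr_ge0; last by rewrite invr_ge0.
    by apply: mulr_ge0; [exact: ltW|exact: expR_ge0].
  by rewrite mulrAC.
apply: (le_trans (claim n)); apply: ler_wpM2r; first by rewrite ltW// sqrt_coef_gt0.
rewrite -[X in X <= _]addr0 lerD ?mulr_ge0 ?expR_ge0 ?(ltW c0)//.
by rewrite ler_wpM2l ?(ltW D0)// ler_expR ler_wpM2l// gerBl invr_ge0 ltW.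
Qed.

(** Telescoping: by [sqrt_coefSM], [sqrt_coef m] is the drop of [2 * (m.+1%:R * sqrt_coef m)] from
    [m] to [m.+1]. *)
Lemma sum_sqrt_coef N :
  \sum_(m < N) sqrt_coef m = 1 - 2 * (N.+1%:R * sqrt_coef N).
Proof.
elim: N => [|N IH]; first by rewrite big_ord0 sqrt_coef0 mul1r divff// subrr.
by rewrite big_ord_recr /= IH sqrt_coefSM -natr1; field.
Qed.

(** A Wallis-type bound: the squared quantity is the central binomial coefficient of [2N] over
    [4 ^ N], and the whole expression decreases with [N]. *)
Lemma sqrt_coef_sqr_le N : (2 * (N.+1%:R * sqrt_coef N)) ^+ 2 * (2 * N%:R + 1) <= 1.
Proof.
elim: N => [|N IH]; first by rewrite sqrt_coef0 mul1r divff// mulr0 add0r expr1n mulr1.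
apply: le_trans IH; rewrite sqrt_coefSM.
rewrite -[N.+1%:R]natr1 !exprMn.
have -> : 2 ^+ 2 * ((N%:R + 2^-1) ^+ 2 * sqrt_coef N ^+ 2) * (2 * (N%:R + 1) + 1) =
  ((2 * N%:R + 1) ^+ 2 * (2 * N%:R + 3)) * sqrt_coef N ^+ 2 :> R by field.
have -> : 2 ^+ 2 * ((N%:R + 1) ^+ 2 * sqrt_coef N ^+ 2) * (2 * N%:R + 1) =
  ((2 * N%:R + 2) ^+ 2 * (2 * N%:R + 1)) * sqrt_coef N ^+ 2 :> R by ring.
rewrite ler_wpM2r ?exprn_ge0 ?ltW ?sqrt_coef_gt0//.
by have := ler0n R N; move: (N%:R) => x x0; nra.
Qed.

Lemma sqrt_coef_cvg0 : (fun N => N.+1%:R * sqrt_coef N) @ \oo --> (0 : R).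
Proof.
apply/cvgrPdist_le => e e0.
near=> N.
have y0 : 0 <= N.+1%:R * sqrt_coef N by rewrite mulr_ge0// ltW// sqrt_coef_gt0.
rewrite sub0r normrN ger0_norm//.
rewrite -(@ler_pXn2r _ 2) ?nnegrE ?(ltW e0)//.
set y := N.+1%:R * _ in y0 *; have H := sqrt_coef_sqr_le N; rewrite -/y in H.
have HN : (e ^+ 2)^-1 <= N%:R by near: N; exact: nbhs_infty_ger.
have H2 : 1 <= e ^+ 2 * N%:R by rewrite mulrC -ler_pdivrMr ?exprn_gt0// div1r.
have N0 : (0:R) <= N%:R by [].
have : y ^+ 2 * (2 * N%:R + 1) <= e ^+ 2 * (2 * N%:R + 1).
  have := exprn_ge0 2 (ltW e0); have: 0 <= y ^+ 2 by rewrite sqr_ge0.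
  rewrite exprMn in H; move: (y ^+ 2) (e ^+ 2) H H2 => a b; nra.
by rewrite ler_pM2r//; nra.
Unshelve. all: end_near. Qed.

Lemma sum_lap_coef_bounded c : 0 < c ->
  exists A : R, forall N, \sum_(n < N) lap_coef c n <= A.
Proof.
move=> c0; have [C C0 HC] := lap_coef_le_sqrt c0.
exists (lap_coef c 0 + C); case=> [|N].
  by rewrite big_ord0 addr_ge0 ?ltW ?lap_coef_gt0.
rewrite big_ord_recl lerD2l; apply: (@le_trans _ _ (\sum_(m < N) C * sqrt_coef m)).
  by apply: ler_sum => i _; exact: HC.
rewrite -mulr_sumr sum_sqrt_coef -[X in _ <= X]mulr1 ler_wpM2l ?(ltW C0)//.
by rewrite gerBl !mulr_ge0// ltW// sqrt_coef_gt0.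
Qed.

(** * Eigenvalues of the kernels [(x . z) ^ n] and of [- sqrt (1 - x . z)] *)

Section SphereMoment.
Variables (w : R) (d : nat).

(* [moment n k] is the eigenvalue of the kernel [(x . z) ^ n] on the spherical
   harmonics of degree [k], when the sphere has total mass [w]. *)
Fixpoint moment n k : R :=
  match n, k with
  | 0, 0 => w
  | 0, _ => 0
  | m.+1, 0 => moment m 1
  | m.+1, j.+1 => m.+1%:R / (m + j + d)%:R * moment m j
  end.

Lemma moment0S k : moment 0 k.+1 = 0. Proof. by []. Qed.

(** Behind this clause: integrating [(x . z) ^ n.+1] against 1 is integrating [(x . z) ^ n] against
    the degree-1 harmonic [z -> x . z], whose value at [x] is 1. *)
Lemma momentS0 n : moment n.+1 0 = moment n 1. Proof. by []. Qed.

Hypotheses (w0 : 0 < w) (d0 : (0 < d)%N).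

Let nkd_neq0 n k : (n + k + d)%:R != 0 :> R.
Proof. by rewrite pnatr_eq0 -lt0n addn_gt0 d0 orbT. Qed.

Lemma momentSS n k : (n + k + d)%:R * moment n.+1 k.+1 = n.+1%:R * moment n k.
Proof. by rewrite /= -/moment mulrA mulrCA divff ?mulr1. Qed.

Lemma moment_ge0 n k : 0 <= moment n k.
Proof.
elim: n k => [|n IH] [|k] //=; first exact: ltW.
by rewrite mulr_ge0// divr_ge0.
Qed.

Lemma moment_diag_gt0 k : 0 < moment k k.
Proof.
elim: k => [|k IH] //=; rewrite mulr_gt0// divr_gt0// ltr0n.
by rewrite addn_gt0 d0 orbT.
Qed.

Lemma moment_le n k : moment n k <= w.
Proof.
elim: n k => [|n IH] [|k] //=; first exact: ltW.
apply: le_trans (IH k); rewrite ler_piMl ?moment_ge0//.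
by rewrite ler_pdivrMr ?mul1r ?ler_nat ?ltr0n ?addn_gt0 ?d0 ?orbT// -addnA -addn1
  leq_add2l addn_gt0 d0 orbT.
Qed.

Lemma momentSSE n k :
  moment n.+1 k.+1 = n.+1%:R / (n + k + d)%:R * moment n k.
Proof. by []. Qed.

Arguments moment : simpl never.

(** With [momentSS], this is the second relation between neighbouring eigenvalues: one raises the
    degree of the harmonic, the other lowers it. The difference is taken in [R], as [k] may exceed
    [n.+1]. *)
Lemma moment_down n k :
  n.+1%:R * moment n k.+1 = (n.+1%:R - k%:R) * moment n.+1 k.
Proof.
elim: n k => [|n IH] [|k]; rewrite ?momentS0 ?subr0//.
  rewrite moment0S mulr0; case: k => [|k]; first by rewrite subrr mul0r.
  by rewrite momentSSE moment0S !mulr0.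
apply: (mulfI (nkd_neq0 n.+1 k)).
rewrite [RHS]mulrCA momentSS addSnnS mulrCA momentSS IH.
by rewrite -[n.+2%:R]natr1 -[k.+1%:R]natr1; ring.
Qed.

(** The relation obtained by integrating the Laplacian of [(x . z) ^ n * p z], with [p] harmonic of
    degree [k]; it later identifies [moment] with an integral. Wherever a predecessor truncates, its
    coefficient is zero. *)
Lemma moment_laplacian n k :
  (n + k)%:R * ((n + k)%:R + d%:R - 2) * moment n k =
  n%:R * (n%:R - 1) * moment n.-2 k + 2 * n%:R * k%:R * moment n.-1 k.-1.
Proof.
case: n => [|[|n]].
- by case: k => [|k]; rewrite ?moment0S; ring.
- case: k => [|[|k]].
  + by rewrite momentS0 moment0S; ring.
  + have := momentSS 0 0; rewrite !add0n => e.
    by rewrite [_.-1]/= [moment 1.-1 _](_ : _ = 1 * moment 0 0) ?mul1r// -[moment 0 0]mul1r -e; ring.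
  + by rewrite momentSSE /= moment0S; ring.
- case: k => [|k].
  + have := nkd_neq0 n 0; have := momentSS n 0; rewrite momentS0 [n.+2.-2]/= !addn0 => e nd.
    apply: (@eq_trans _ _ (n.+2%:R * ((n + d)%:R * moment n.+1 1))).
      by rewrite natrD; ring.
    by rewrite e; ring.
  + have := momentSS n.+1 k; have := moment_down n k.
    rewrite [n.+2.-2]/= [n.+2.-1]/= [k.+1.-1]/= => e1 e2.
    apply: (@eq_trans _ _ ((n.+2 + k.+1)%:R * ((n.+1 + k + d)%:R * moment n.+2 k.+1))).
      by rewrite !natrD -!natr1; ring.
    rewrite e2; have -> : n.+2%:R - 1 = n.+1%:R :> R by rewrite -[n.+2%:R]natr1 addrK.
    rewrite -[n.+2%:R * n.+1%:R * _]mulrA e1 natrD -[n.+2%:R]natr1 -[n.+1%:R]natr1.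
    by rewrite -[k.+1%:R]natr1; ring.
Qed.

(* Recurrence in [k] for the eigenvalues of [- sqrt (1 - t)]. It is stated for
   truncated series with boundary terms because the series attached to its
   derivative diverges when [d = 2]. *)
Lemma sqrt_moment_recurrence k N : (0 < k)%N ->
  (k%:R + d%:R - 2^-1) * (\sum_(m < N) sqrt_coef m * moment m.+1 k.+1) +
    N.+1%:R * sqrt_coef N * moment N k.+1 =
  (k%:R - 2^-1) * (\sum_(m < N) sqrt_coef m * moment m.+1 k) -
    N.+1%:R * sqrt_coef N * moment N k.
Proof.
case: k => // k _; elim: N => [|N IH].
  by rewrite !big_ord0 !moment0S !mulr0 addr0 subr0.
rewrite !big_ord_recr /= !sqrt_coefSM.
have e1 := momentSS N k.+1; have e2 := moment_down N k.+1.
move: IH e1 e2.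
set S1 := \sum_(i < N) _; set S2 := \sum_(i < N) _; rewrite !natrD.
move: (moment N.+1 k.+2) (moment N.+1 k.+1) (moment N k.+2) (moment N k.+1) => p q r s.
rewrite -[N.+1%:R]natr1.
move: (N%:R) (k.+1%:R) (d%:R) (sqrt_coef N) => x y z b IH e1 e2.
apply/eqP; rewrite -subr_eq0; apply/eqP.
have {}IH : (y + z - 2^-1) * S1 = (y - 2^-1) * S2 - (x + 1) * b * s - (x + 1) * b * r.
  by rewrite -IH addrK.
rewrite !mulrDr IH.
have -> : (y + z - 2^-1) * (b * p) = b * ((x + y + z) * p) - b * (x + 2^-1) * p by ring.
rewrite e1; have -> : (x + 1) * b * r = b * ((x + 1) * r) by ring.
by rewrite e2; field.
Qed.

Lemma is_cvg_moment_series (u : nat -> R) (v : nat -> nat) k (A : R) :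
  (forall n, 0 <= u n) -> (forall N, \sum_(n < N) u n <= A) ->
  cvgn (fun N => \sum_(n < N) u n * moment (v n) k).
Proof.
move=> u0 uA; apply: nondecreasing_is_cvgn.
  apply/nondecreasing_seqP => n; rewrite big_ord_recr /= lerDl.
  by rewrite mulr_ge0// moment_ge0.
exists (A * w) => _ [N _ <-]; apply: (@le_trans _ _ (\sum_(n < N) u n * w)).
  by apply: ler_sum => i _; rewrite ler_wpM2l// moment_le.
by rewrite -mulr_suml ler_wpM2r// ltW.
Qed.

(** The constant term [-1] of [- sqrt (1 - t)] is left out; it acts only on degree 0, so this is the
    eigenvalue of that kernel for [k > 0]. *)
Definition sqrt_eig k := limn (fun N => \sum_(m < N) sqrt_coef m * moment m.+1 k).

Lemma sum_sqrt_coef_le1 N : \sum_(m < N) sqrt_coef m <= 1.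
Proof. by rewrite sum_sqrt_coef gerBl !mulr_ge0// ltW// sqrt_coef_gt0. Qed.

Lemma sqrt_eig_cvg k :
  (fun N => \sum_(m < N) sqrt_coef m * moment m.+1 k) @ \oo --> sqrt_eig k.
Proof.
apply: (@is_cvg_moment_series sqrt_coef S k 1); last exact: sum_sqrt_coef_le1.
by move=> n; rewrite ltW// sqrt_coef_gt0.
Qed.

(** Limit of the truncated recurrence: the boundary terms are at most [N.+1%:R * sqrt_coef N * w],
    which tends to 0. *)
Lemma sqrt_eigS k : (0 < k)%N ->
  (k%:R + d%:R - 2^-1) * sqrt_eig k.+1 = (k%:R - 2^-1) * sqrt_eig k.
Proof.
move=> k0.
have eps j : (fun N => N.+1%:R * sqrt_coef N * moment N j) @ \oo --> (0 : R).
  apply: (@squeeze_cvgr _ _ _ _ (fun=> 0) (fun N => N.+1%:R * sqrt_coef N * w)).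
  - near=> N; rewrite !mulr_ge0 ?moment_ge0 ?(ltW (sqrt_coef_gt0 N))//=.
    by rewrite ler_wpM2l ?moment_le// mulr_ge0// ltW// sqrt_coef_gt0.
  - exact: cvg_cst.
  - by rewrite -[X in _ --> X](mul0r w); apply: cvgMl; exact: sqrt_coef_cvg0.
have h1 : (fun N => (k%:R + d%:R - 2^-1) * (\sum_(m < N) sqrt_coef m * moment m.+1 k.+1) +
    N.+1%:R * sqrt_coef N * moment N k.+1) @ \oo --> (k%:R + d%:R - 2^-1) * sqrt_eig k.+1 + 0.
  by apply: cvgD; [apply: cvgMr; exact: sqrt_eig_cvg|exact: eps].
have h2 : (fun N => (k%:R - 2^-1) * (\sum_(m < N) sqrt_coef m * moment m.+1 k) -
    N.+1%:R * sqrt_coef N * moment N k) @ \oo --> (k%:R - 2^-1) * sqrt_eig k - 0.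
  by apply: cvgB; [apply: cvgMr; exact: sqrt_eig_cvg|exact: eps].
rewrite addr0 in h1; rewrite subr0 in h2.
rewrite (_ : (fun N => _) = (fun N => (k%:R - 2^-1) * (\sum_(m < N) sqrt_coef m * moment m.+1 k) -
    N.+1%:R * sqrt_coef N * moment N k)) in h1; last first.
  by apply/funext => N; exact: sqrt_moment_recurrence.
exact: (cvg_unique _ h1 h2).
Unshelve. all: end_near. Qed.

Lemma sqrt_eigE k :
  sqrt_eig k.+1 * \prod_(j < d) (k.+1%:R - 2^-1 + j%:R) =
  sqrt_eig 1 * \prod_(j < d) (2^-1 + j%:R).
Proof.
elim: k => [|k IH].
  by congr (_ * _); apply: eq_bigr => j _; field.
rewrite -IH; have := sqrt_eigS (ltn0Sn k).
(* Raising [k] by one shifts the window of factors: the lowest one leaves and a new highest one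
   enters, and these are the two coefficients of [sqrt_eigS]. *)
case: d d0 => // d' _; rewrite big_ord_recr big_ord_recl /= addr0 => e.
rewrite [in RHS](eq_bigr (fun i : 'I_d' => k.+2%:R - 2^-1 + i%:R)); last first.
  by move=> i _; rewrite /bump leq0n add1n -[k.+2%:R]natr1 -[i.+1%:R]natr1; ring.
rewrite [in RHS]mulrA [sqrt_eig k.+1 * _]mulrC -e.
by rewrite -[d'.+1%:R]natr1 -[k.+2%:R]natr1; ring.
Qed.

Lemma sqrt_eig1_gt0 : 0 < sqrt_eig 1.
Proof.
apply: (@lt_le_trans _ _ (sqrt_coef 0 * moment 1 1)).
  by rewrite mulr_gt0 ?sqrt_coef_gt0 ?moment_diag_gt0.
apply: limr_ge; first by apply: cvgP; exact: sqrt_eig_cvg.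
near=> N.
have N0 : (0 < N)%N by near: N; exact: nbhs_infty_gt.
rewrite (bigD1 (Ordinal N0)) //= lerDl sumr_ge0// => i _.
by rewrite mulr_ge0 ?moment_ge0 ?ltW ?sqrt_coef_gt0.
Unshelve. all: end_near. Qed.

Lemma sqrt_eig_bounds : exists B1 B2 : R, 0 < B1 /\ 0 < B2 /\
  forall k, (0 < k)%N -> B1 * k%:R ^- d <= sqrt_eig k /\ sqrt_eig k <= B2 * k%:R ^- d.
Proof.
pose A := sqrt_eig 1 * \prod_(j < d) (2^-1 + j%:R).
have A0 : 0 < A.
  by rewrite mulr_gt0 ?sqrt_eig1_gt0// prodr_gt0// => j _; rewrite ltr_wpDr// invr_gt0.
(* Each of the [d] factors of the product lies between [k / 2] and [(d + 1) * k]. *)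
exists (A / (d.+1)%:R ^+ d), (A * 2 ^+ d); split; first by rewrite divr_gt0// exprn_gt0.
split; first by rewrite mulr_gt0// exprn_gt0.
case=> // k _; set y := k.+1%:R.
have y1 : 1 <= y by rewrite /y ler1n.
have y0 : 0 < y by rewrite /y.
have pos (j : 'I_d) : 0 < y - 2^-1 + j%:R.
  by rewrite ltr_wpDr// subr_gt0; lra.
set P := \prod_(j < d) (y - 2^-1 + j%:R).
have P0 : 0 < P by rewrite prodr_gt0.
have -> : sqrt_eig k.+1 = A / P.
  by apply: (mulIf (lt0r_neq0 P0)); rewrite sqrt_eigE -/A mulfVK// gt_eqF.
split.
  rewrite -mulrA -invfM ler_wpM2l ?(ltW A0)// lef_pV2 ?posrE ?mulr_gt0 ?exprn_gt0//.
  rewrite -exprMn -[X in _ ^+ X]card_ord -prodr_const; apply: ler_prod => j _.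
  rewrite ltW ?pos//=.
  have : j%:R <= d%:R :> R by rewrite ler_nat ltnW.
  have : d%:R <= d%:R * y by rewrite ler_peMr.
  by rewrite -[d.+1%:R]natr1; lra.
rewrite -mulrA ler_wpM2l ?(ltW A0)//.
rewrite -[2 ^+ d]invrK -invfM lef_pV2 ?posrE ?mulr_gt0 ?invr_gt0 ?exprn_gt0//.
rewrite -exprVn -exprMn -[X in _ ^+ X]card_ord -prodr_const; apply: ler_prod => j _.
have : 0 <= j%:R :> R by [].
by move=> ?; apply/andP; split; lra.
Qed.

End SphereMoment.

(** * Positivity and decay of the eigenvalues of the Laplace kernel *)

Section LaplaceEigenvalue.
Variables (c w : R) (d : nat).
Hypotheses (c0 : 0 < c) (w0 : 0 < w) (d0 : (0 < d)%N).

Definition lap_eig k := limn (fun N => \sum_(n < N) lap_coef c n * moment w d n k).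

Lemma lap_eig_cvg k :
  (fun N => \sum_(n < N) lap_coef c n * moment w d n k) @ \oo --> lap_eig k.
Proof.
have [A HA] := sum_lap_coef_bounded c0.
apply: (@is_cvg_moment_series w d w0 d0 (lap_coef c) id k A) => // n.
by rewrite ltW// lap_coef_gt0.
Qed.

(** All terms are nonnegative, and the one with [n = k] is positive. *)
Lemma lap_eig_gt0 k : 0 < lap_eig k.
Proof.
apply: (@lt_le_trans _ _ (lap_coef c k * moment w d k k)).
  by rewrite mulr_gt0 ?lap_coef_gt0 ?moment_diag_gt0.
apply: limr_ge; first by apply: cvgP; exact: lap_eig_cvg.
near=> N.
have kN : (k < N)%N by near: N; exact: nbhs_infty_gt.
rewrite (bigD1 (Ordinal kN)) //= lerDl sumr_ge0// => i _.
by rewrite mulr_ge0 ?moment_ge0 ?ltW ?lap_coef_gt0.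
Unshelve. all: end_near. Qed.

Lemma lap_eig_bounds : exists B1 B2 : R, 0 < B1 /\ 0 < B2 /\
  forall k, (0 < k)%N -> B1 * k%:R ^- d <= lap_eig k /\ lap_eig k <= B2 * k%:R ^- d.
Proof.
have [B1 [B2 [B10 [B20 HB]]]] := sqrt_eig_bounds w0 d0.
have [C C0 HC] := lap_coef_le_sqrt c0.
have D0 : 0 < c * expR (- c) by rewrite mulr_gt0 ?expR_gt0.
exists (c * expR (- c) * B1), (C * B2); do 2 (split; first by rewrite mulr_gt0).
move=> k k0; have [h1 h2] := HB _ k0.
have cvS : (fun N => \sum_(n < N.+1) lap_coef c n * moment w d n k) @ \oo --> lap_eig k.
  by rewrite (cvg_shiftS (fun N => \sum_(n < N) lap_coef c n * moment w d n k)); exact: lap_eig_cvg.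
have cvM (D : R) : (fun N => D * \sum_(m < N) sqrt_coef m * moment w d m.+1 k) @ \oo --> D * sqrt_eig w d k.
  by apply: cvgMr; exact: sqrt_eig_cvg.
(* For [k > 0] the constant term of the profile contributes nothing, so the series starts at [n = 1]
   and lines up with [sqrt_coef]. *)
have m0 : moment w d 0 k = 0 by case: (k) k0.
have dist (D : R) N : D * (\sum_(m < N) sqrt_coef m * moment w d m.+1 k) = \sum_(m < N) D * sqrt_coef m * moment w d m.+1 k.
  by rewrite mulr_sumr; apply: eq_bigr => i _; rewrite mulrA.
split.
  rewrite -mulrA; apply: le_trans (ler_wpM2l (ltW D0) h1) _.
  apply: (ler_cvg_to (cvM _) cvS); apply: nearW => N.
  rewrite big_ord_recl m0 mulr0 add0r dist; apply: ler_sum => i _.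
  by rewrite ler_wpM2r ?moment_ge0// sqrt_coef_le_lap.
rewrite -mulrA; apply: le_trans (ler_wpM2l (ltW C0) h2).
apply: (ler_cvg_to cvS (cvM _)); apply: nearW => N.
rewrite big_ord_recl m0 mulr0 add0r dist; apply: ler_sum => i _.
by rewrite ler_wpM2r ?moment_ge0//; exact: HC.
Qed.

End LaplaceEigenvalue.
End Coefficients.

(** * Lebesgue integrals on the line and the plane: Fubini, shears, rotations *)

Section RealIntegral.
Variable R : realType.
Local Notation mu := (@lebesgue_measure R).

Lemma lebesgue_measure_sym_itv (M : R) : 0 <= M -> mu `[- M, M]%classic = (2 * M)%:E.
Proof.
move=> M0; have := lebesgue_measure_itv `[- M, M]; rewrite /= lte_fin => ->.
case: ltP => [_|hM]; first by rewrite -EFinB; congr EFin; ring.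
by have -> : M = 0 by [lra]; rewrite mulr0.
Qed.

Lemma bounded_integrable_itv (g : R -> R) (M B : R) :
  measurable_fun setT g -> (forall t, `|g t| <= B) ->
  mu.-integrable `[- M, M]%classic (EFin \o g).
Proof.
move=> mg gB; apply: measurable_bounded_integrable.
- exact: measurable_itv.
- have := lebesgue_measure_itv `[- M, M]; rewrite /= => ->.
  by case: ifP => _; rewrite -?EFinB ltry.
- exact: measurable_funTS.
- by exists B; split; [exact: num_real|move=> y By t _ /=; exact: le_trans (gB t) (ltW By)].
Qed.

Lemma bounded_support_integrable (g : R -> R) (M B : R) :
  measurable_fun setT g -> (forall t, `|g t| <= B) ->
  (forall t, g t != 0 -> `|t| <= M) -> mu.-integrable setT (EFin \o g).
Proof.
move=> mg gB gM.
have -> : EFin \o g = (EFin \o g) \_ `[- M, M]%classic.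
  apply/funext => t; rewrite /patch; case: ifPn => // /negP tM /=.
  congr EFin; apply/eqP/negPn/negP => /gM tM'; apply: tM.
  by rewrite inE /= in_itv /= -ler_norml.
apply: (iffLR (@integrable_mkcond _ _ R mu `[- M, M]%classic (EFin \o g) (measurable_itv _))).
exact: bounded_integrable_itv gB.
Qed.

Lemma bounded_support_integral_le (g : R -> R) (M B : R) :
  measurable_fun setT g -> (forall t, `|g t| <= B) -> 0 <= M ->
  (forall t, g t != 0 -> `|t| <= M) -> `|Rintegral mu setT g| <= B * (2 * M).
Proof.
move=> mg gB M0 gM.
apply: le_trans (le_normr_Rintegral measurableT (bounded_support_integrable mg gB gM)) _.
have B0 : 0 <= B by apply: le_trans (gB 0).
have -> : B * (2 * M) = Rintegral mu `[- M, M]%classic (fun=> B).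
  rewrite Rintegral_cst; last exact: measurable_itv.
  by congr (_ * _); exact: (esym (congr1 fine (lebesgue_measure_sym_itv M0))).
rewrite [leRHS]Rintegral_mkcond; apply: le_Rintegral => //.
- apply: (@bounded_support_integrable _ M B).
  + by apply: measurableT_comp => //.
  + by move=> t; rewrite normr_id.
  + by move=> t; rewrite normr_eq0; exact: gM.
- rewrite -restrict_EFin.
  apply: (iffLR (@integrable_mkcond _ _ R mu `[- M, M]%classic (EFin \o cst B) (measurable_itv _))).
  by apply: (@bounded_integrable_itv _ _ B) => // t; rewrite ger0_norm.
- move=> t _; rewrite /patch; case: ifPn => // /negP tM.
  suff -> : g t = 0 by rewrite normr0.
  apply/eqP/negPn/negP => /gM tM'; apply: tM.
  by rewrite inE /= in_itv /= -ler_norml.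
Qed.

Lemma measurable_translate (a : R) :
  measurable_fun setT ((fun t => t + a) : measurableTypeR R -> measurableTypeR R).
Proof. exact: measurable_funD. Qed.

(** Uniqueness of the Lebesgue measure reduces the claim to half-open intervals. *)
Lemma lebesgue_measure_translate (a : R) (A : set R) : measurable A ->
  pushforward mu ((fun t => t + a) : measurableTypeR R -> measurableTypeR R) A = mu A.
Proof.
move=> mA; apply/esym/lebesgue_measure_unique => //=.
  exact: measurable_translate.
move=> mt _ [[x y]] _ <-.
rewrite /pushforward.
have -> : (fun t : R => t + a) @^-1` `]x, y]%classic = `]x - a, y - a]%classic.
  by apply/seteqP; split => t /=; rewrite !in_itv /= ltrBlDr lerBrDr.
rewrite !lebesgue_measure_itv /= !lte_fin ltrD2r; case: ifP => // _.
by rewrite -!EFinB; congr EFin; ring.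
Qed.

Lemma Rintegral_translate (g : R -> R) (a : R) :
  mu.-integrable setT (EFin \o (fun t => g (t + a))) -> measurable_fun setT g ->
  Rintegral mu setT (fun t => g (t + a)) = Rintegral mu setT g.
Proof.
move=> ig mg; rewrite /Rintegral; congr fine.
transitivity (\int[pushforward mu ((fun t => (t + a)%R) : measurableTypeR R -> measurableTypeR R)]_t (g t)%:E)%E.
  have mEg : measurable_fun setT (EFin \o g) by exact/measurable_EFinP.
  have := @integral_pushforward _ _ _ _ R _ (measurable_translate a) mu setT (EFin \o g) mEg.
  by move=> /(_ ig measurableT) ->.
apply: eq_measure_integral.
  exact: measurable_translate.
move=> mt A mA _; exact: (lebesgue_measure_translate a mA).
Qed.

(** Tonelli gives measurability for nonnegative integrands; it is applied to the positive and
    negative parts separately. *)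
Lemma measurable_Rintegral_param (dU : measure_display) (U : measurableType dU)
    (G : U * R -> R) : measurable_fun setT G ->
  measurable_fun setT (fun u => Rintegral mu setT (fun t => G (u, t))).
Proof.
move=> mG; rewrite /Rintegral; apply: measurableT_comp => //.
under eq_fun do rewrite integralE.
have mE : measurable_fun setT (EFin \o G) by exact/measurable_EFinP.
have hF (F : U * R -> \bar R) : measurable_fun setT F -> (forall p, 0 <= F p)%E ->
    measurable_fun setT (fun u => \int[mu]_t F (u, t))%E.
  by move=> mF F0; exact: (@measurable_fun_fubini_tonelli_F _ _ U _ R mu F mF F0).
apply: emeasurable_funB.
- have mF : measurable_fun setT (EFin \o G)^\+%E by exact: measurable_funepos.
  have h := hF _ mF (fun p => funepos_ge0 (EFin \o G) p).
  apply: eq_measurable_fun h => u _; apply: eq_integral => t _.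
  exact: (esym (congr1 (fun F => F t) (funepos_comp (EFin \o G) (pair u)))).
- have mF : measurable_fun setT (EFin \o G)^\-%E by exact: measurable_funeneg.
  have h := hF _ mF (fun p => funeneg_ge0 (EFin \o G) p).
  apply: eq_measurable_fun h => u _; apply: eq_integral => t _.
  exact: (esym (congr1 (fun F => F t) (funeneg_comp (EFin \o G) (pair u)))).
Qed.

(** A class on which Fubini always applies and which is stable under swaps and shears. A single [M]
    bounds both the values and the support. *)
Definition planar (G : R -> R -> R) := measurable_fun setT (fun p : R * R => G p.1 p.2) /\
  exists2 M : R, 0 <= M & forall s t, `|G s t| <= M /\ (G s t != 0 -> `|s| <= M /\ `|t| <= M).

Definition pint (G : R -> R -> R) := Rintegral mu setT (fun s => Rintegral mu setT (G s)).

Lemma planar_section G s : planar G -> mu.-integrable setT (EFin \o G s).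
Proof.
move=> [mG [M M0 GM]].
apply: (@bounded_support_integrable _ M M).
- exact: (measurable_fun_pair2 s mG).
- by move=> t; exact: (GM s t).1.
- by move=> t /(GM s t).2[].
Qed.

Lemma planar_swap G : planar G -> planar (fun s t => G t s).
Proof.
move=> [mG [M M0 GM]]; split.
  exact: (measurableT_comp mG (@measurable_swap _ _ R R)).
by exists M => // s t; have [h1 h2] := GM t s; split => // /h2[].
Qed.

Lemma pint_swap G : planar G -> pint (fun s t => G t s) = pint G.
Proof.
move=> pG; have pG' := planar_swap pG; case: (pG) => mG [M M0 GM].
(* The inner integrals are finite, so the inner [fine] can be removed and Fubini applied to
   extended-real integrals. *)
have E H : planar H -> pint H = fine (\int[mu]_s \int[mu]_t (H s t)%:E)%E.
  move=> pH; rewrite /pint [LHS]/Rintegral; congr fine; apply: eq_integral => s _.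
  by rewrite /Rintegral fineK//; apply: integrable_fin_num => //; exact: planar_section.
rewrite !E//; congr fine; symmetry.
apply: (@Fubini _ _ _ _ _ mu mu (fun p : R * R => (G p.1 p.2)%:E)).
apply/integrable12ltyP; first exact/measurable_EFinP.
have h s : (\int[mu]_y `|(G s y)%:E| = (Rintegral mu setT (fun y => `|G s y|))%:E)%E.
  rewrite /Rintegral fineK//; apply: integrable_fin_num => //.
  by have := integrable_abse (planar_section s pG).
have -> : (\int[mu]_x \int[mu]_y `|(G (x, y).1 (x, y).2)%:E| =
    \int[mu]_x (Rintegral mu setT (fun y => `|G x y|))%:E)%E.
  by apply: eq_integral => s _; exact: h.
have : mu.-integrable setT (EFin \o (fun s => Rintegral mu setT (fun y => `|G s y|))).
  apply: (@bounded_support_integrable _ M (M * (2 * M))).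
  - apply: (@measurable_Rintegral_param _ R (fun p => `|G p.1 p.2|)).
    by apply: measurableT_comp => //.
  - move=> s; apply: bounded_support_integral_le => //.
    + by apply: measurableT_comp => //; exact: (measurable_fun_pair2 s mG).
    + by move=> t; rewrite normr_id; exact: (GM s t).1.
    + by move=> t; rewrite normr_eq0 => /(GM s t).2[].
  - move=> s; apply: contraNT => sM; rewrite (_ : (fun y => _) = cst 0).
      by rewrite Rintegral_cst// mul0r.
    apply/funext => y /=; apply/eqP; rewrite normr_eq0; apply: contraNT sM.
    by move=> /(GM s y).2[].
move=> /integrableP[_]; apply: le_lt_trans; apply: ge0_le_integral => //.
- by move=> s _; rewrite lee_fin Rintegral_ge0.
- apply/measurable_EFinP; apply: (@measurable_Rintegral_param _ R (fun p => `|G p.1 p.2|)).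
  by apply: measurableT_comp => //.
- apply: measurableT_comp => //.
  apply/measurable_EFinP; apply: (@measurable_Rintegral_param _ R (fun p => `|G p.1 p.2|)).
  by apply: measurableT_comp => //.
- by move=> s _ /=; rewrite lee_fin ler_norm.
Qed.

Lemma planar_shear G (a : R) : planar G -> planar (fun s t => G s (t + a * s)).
Proof.
move=> [mG [M M0 GM]]; split.
  have h : measurable_fun setT (fun p : R * R => (p.1, p.2 + a * p.1)).
    apply: measurable_fun_pair; first exact: measurable_fst.
    apply: measurable_funD; first exact: measurable_snd.
    by apply: measurable_funM; [exact: measurable_cst|exact: measurable_fst].
  exact: (measurableT_comp mG h).
exists (M + `|a| * M); first by rewrite addr_ge0// mulr_ge0.
move=> s t; have [h1 h2] := GM s (t + a * s).
have aM : 0 <= `|a| * M by rewrite mulr_ge0.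
split; first by rewrite (le_trans h1)// lerDl.
move=> /h2[sM tM]; split; first by rewrite (le_trans sM)// lerDl.
rewrite -[t](addrK (a * s)); apply: le_trans (ler_normB _ _) _.
by rewrite lerD// normrM ler_wpM2l.
Qed.

Lemma pint_shear G (a : R) : planar G -> pint (fun s t => G s (t + a * s)) = pint G.
Proof.
move=> pG; rewrite /pint; congr (Rintegral _ _ _); apply/funext => s.
rewrite Rintegral_translate//; last first.
  by case: pG => mG _; exact: (measurable_fun_pair2 s mG).
exact: (planar_section s (planar_shear a pG)).
Qed.

Lemma planar_shear_l G (a : R) : planar G -> planar (fun s t => G (s + a * t) t).
Proof. by move=> pG; exact: (planar_swap (planar_shear a (planar_swap pG))). Qed.

Lemma pint_shear_l G (a : R) : planar G -> pint (fun s t => G (s + a * t) t) = pint G.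
Proof.
move=> pG; rewrite -(pint_swap (planar_shear_l a pG)) -(pint_swap pG).
exact: (pint_shear a (planar_swap pG)).
Qed.

(* A rotation is a product of three shears, and each shear preserves the
   integral by Fubini and translation invariance. *)
Lemma pint_rot G (c s : R) : s != 0 -> c ^+ 2 + s ^+ 2 = 1 -> planar G ->
  pint (fun x y => G (c * x - s * y) (s * x + c * y)) = pint G.
Proof.
(* With [c] and [s] the cosine and sine of an angle, [a] is minus the tangent of the half angle: the
   slope of the two outer shears. The middle shear has slope [s]. *)
move=> s0 cs pG; pose a := (c - 1) / s.
have as_ : a * s = c - 1 by rewrite /a divfK.
have cE : 1 + a * s = c by rewrite as_; ring.
have ac : a * (1 + c) = - s.
  by apply: (mulIf s0); rewrite mulrAC as_ mulNr -expr2 -[s ^+ 2](addKr (c ^+ 2)) cs; ring.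
pose G1 x y := G (x + a * y) y; pose G2 x y := G1 x (y + s * x).
have p1 : planar G1 by exact: planar_shear_l.
have p2 : planar G2 by exact: planar_shear.
rewrite -(pint_shear_l a pG) -/G1 -(pint_shear s p1) -/G2 -(pint_shear_l a p2).
rewrite /G2 /G1; congr pint; apply/funext => x; apply/funext => y; congr G.
  rewrite -[in LHS]cE -[s * y]opprK -mulNr -ac -cE; ring.
by rewrite -cE; ring.
Qed.

End RealIntegral.

(** * The iterated integral over row vectors *)

Section IteratedIntegral.
Variable R : realType.
Local Notation mu := (@lebesgue_measure R).

Definition row_cons n (t : R) (v : 'rV[R]_n) : 'rV[R]_n.+1 := row_mx t%:M v.

Lemma row_cons_0 n t (v : 'rV[R]_n) : row_cons t v 0 ord0 = t.
Proof.
rewrite /row_cons (_ : ord0 = lshift n (ord0 : 'I_1)); last exact/val_inj.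
by rewrite (row_mxEl (t%:M : 'rV_1)) !mxE eqxx mulr1n.
Qed.

Lemma row_cons_lift n t (v : 'rV[R]_n) i : row_cons t v 0 (lift ord0 i) = v 0 i.
Proof.
rewrite /row_cons (_ : lift ord0 i = rshift 1 i); last exact/val_inj.
by rewrite (row_mxEr (t%:M : 'rV_1)).
Qed.

(* Joint measurability of [F] in both arguments, peeling off the coordinates of
   the vector in the order in which [iint] integrates them. *)
Fixpoint jmeas n : forall (dU : measure_display) (U : measurableType dU),
    (U -> 'rV[R]_n -> R) -> Prop :=
  match n with
  | 0 => fun dU U F => measurable_fun setT (fun u => F u 0)
  | m.+1 => fun dU U F =>
      @jmeas m _ (U * R)%type (fun ut v => F ut.1 (row_cons ut.2 v))
  end.

Lemma jmeas_subst n (dU dW : measure_display) (U : measurableType dU)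
    (W : measurableType dW) (phi : W -> U) (F : U -> 'rV[R]_n -> R) :
  measurable_fun setT phi -> jmeas F -> jmeas (fun w => F (phi w)).
Proof.
elim: n dU dW U W phi F => [|n IH] dU dW U W phi F mphi /= mF.
  exact: (measurableT_comp mF mphi).
apply: (IH _ _ _ _ (fun wt : W * R => (phi wt.1, wt.2)) _ _ mF).
apply: measurable_fun_pair; last exact: measurable_snd.
exact: (measurableT_comp mphi measurable_fst).
Qed.

Lemma jmeas_param n (dU : measure_display) (U : measurableType dU) (g : U -> R) :
  measurable_fun setT g -> @jmeas n _ U (fun u _ => g u).
Proof.
elim: n dU U g => [|n IH] dU U g mg //=.
apply: (IH _ _ (fun ut : U * R => g ut.1)).
exact: (measurableT_comp mg measurable_fst).
Qed.

Lemma jmeas_cst n (dU : measure_display) (U : measurableType dU) (a : R) :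
  @jmeas n _ U (fun _ _ => a).
Proof. by apply: jmeas_param; exact: measurable_cst. Qed.

Lemma jmeas_coord n (dU : measure_display) (U : measurableType dU) (i : 'I_n) :
  @jmeas n _ U (fun _ v => v 0 i).
Proof.
elim: n dU U i => [|n IH] dU U; first by case.
move=> i /=; case: (unliftP ord0 i) => [j ->|->].
  rewrite [X in jmeas X](_ : _ = fun (_ : U * R) (v : 'rV[R]_n) => v 0 (j : 'I_n)); first exact: IH.
  by apply/funext => u; apply/funext => v; rewrite row_cons_lift.
rewrite [X in jmeas X](_ : _ = fun ut _ => ut.2).
  by apply: jmeas_param; exact: measurable_snd.
by apply/funext => u; apply/funext => v; rewrite row_cons_0.
Qed.

Lemma jmeas_comp2 n (dU : measure_display) (U : measurableType dU)
    (h : R -> R -> R) (F G : U -> 'rV[R]_n -> R) :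
  measurable_fun setT (fun p : R * R => h p.1 p.2) ->
  jmeas F -> jmeas G -> jmeas (fun u v => h (F u v) (G u v)).
Proof.
move=> mh; elim: n dU U F G => [|n IH] dU U F G /= mF mG.
  exact: (measurableT_comp mh (measurable_fun_pair mF mG)).
exact: IH.
Qed.

Lemma jmeas_comp1 n (dU : measure_display) (U : measurableType dU)
    (h : R -> R) (F : U -> 'rV[R]_n -> R) :
  measurable_fun setT h -> jmeas F -> jmeas (fun u v => h (F u v)).
Proof.
move=> mh mF; apply: (@jmeas_comp2 _ _ _ (fun a _ => h a) F F) => //.
exact: (measurableT_comp mh measurable_fst).
Qed.

Lemma jmeasD n (dU : measure_display) (U : measurableType dU)
  (F G : U -> 'rV[R]_n -> R) : jmeas F -> jmeas G -> jmeas (fun u v => F u v + G u v).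
Proof.
apply: (@jmeas_comp2 _ _ _ +%R).
by apply: measurable_funD; [exact: measurable_fst|exact: measurable_snd].
Qed.

Lemma jmeasM n (dU : measure_display) (U : measurableType dU)
  (F G : U -> 'rV[R]_n -> R) : jmeas F -> jmeas G -> jmeas (fun u v => F u v * G u v).
Proof.
apply: (@jmeas_comp2 _ _ _ *%R).
by apply: measurable_funM; [exact: measurable_fst|exact: measurable_snd].
Qed.

Lemma jmeas_sum n (dU : measure_display) (U : measurableType dU) (I : Type)
    (r : seq I) (F : I -> U -> 'rV[R]_n -> R) :
  (forall i, jmeas (F i)) -> jmeas (fun u v => \sum_(i <- r) F i u v).
Proof.
move=> mF; elim: r => [|i r IH].
  rewrite [X in jmeas X](_ : _ = fun _ _ => 0); first exact: jmeas_cst.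
  by apply/funext => u; apply/funext => v; rewrite big_nil.
rewrite [X in jmeas X](_ : _ = fun u v => F i u v + \sum_(j <- r) F j u v).
  exact: jmeasD.
by apply/funext => u; apply/funext => v; rewrite big_cons.
Qed.

Lemma jmeas_prod n (dU : measure_display) (U : measurableType dU) (I : Type)
    (r : seq I) (F : I -> U -> 'rV[R]_n -> R) :
  (forall i, jmeas (F i)) -> jmeas (fun u v => \prod_(i <- r) F i u v).
Proof.
move=> mF; elim: r => [|i r IH].
  rewrite [X in jmeas X](_ : _ = fun _ _ => 1); first exact: jmeas_cst.
  by apply/funext => u; apply/funext => v; rewrite big_nil.
rewrite [X in jmeas X](_ : _ = fun u v => F i u v * \prod_(j <- r) F j u v).
  exact: jmeasM.
by apply/funext => u; apply/funext => v; rewrite big_cons.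
Qed.

Lemma jmeas_iint n (dU : measure_display) (U : measurableType dU)
    (F : U -> 'rV[R]_n -> R) :
  jmeas F -> measurable_fun setT (fun u => iint (F u)).
Proof.
elim: n dU U F => [|n IH] dU U F //= mF.
exact: (measurable_Rintegral_param (IH _ _ _ mF)).
Qed.

(** The same [M] bounds values and support, so that sections of a boxed function are boxed with the
    same constant and inductions on [n] go through. *)
Definition boxed n (M : R) (f : 'rV[R]_n -> R) := forall v,
  `|f v| <= M /\ (f v != 0 -> forall i, `|v 0 i| <= M).

Definition integrand n (f : 'rV[R]_n -> R) :=
  jmeas (fun (_ : unit) v => f v) /\ exists2 M, 0 <= M & boxed M f.

Lemma jmeas_section n (f : 'rV[R]_n.+1 -> R) (dU : measure_display) (U : measurableType dU)
    (phi : U -> R) : measurable_fun setT phi ->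
  jmeas (fun (_ : unit) v => f v) -> jmeas (fun u v => f (row_cons (phi u) v)).
Proof.
move=> mphi /= mf; apply: (jmeas_subst (phi := fun u => (tt, phi u)) _ mf).
by apply: measurable_fun_pair => //; exact: measurable_cst.
Qed.

Lemma boxed_section n M (f : 'rV[R]_n.+1 -> R) t : boxed M f -> boxed M (fun v => f (row_cons t v)).
Proof.
by move=> fM v; have [h1 h2] := fM (row_cons t v); split => // /h2 h i;
  have := h (lift ord0 i); rewrite row_cons_lift.
Qed.

Lemma boxed_section0 n M (f : 'rV[R]_n.+1 -> R) t v : boxed M f ->
  f (row_cons t v) != 0 -> `|t| <= M.
Proof. by move=> fM /(fM _).2 /(_ ord0); rewrite row_cons_0. Qed.

Lemma integrand_section n (f : 'rV[R]_n.+1 -> R) t :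
  integrand f -> integrand (fun v => f (row_cons t v)).
Proof.
move=> [mf [M M0 fM]]; split; first exact: (jmeas_section (phi := fun=> t)).
by exists M => //; exact: boxed_section.
Qed.

Lemma iintS n (f : 'rV[R]_n.+1 -> R) :
  iint f = Rintegral mu setT (fun t => iint (fun v => f (row_cons t v))).
Proof. by []. Qed.

Lemma iint0 n : iint (fun _ : 'rV[R]_n => 0) = 0 :> R.
Proof.
elim: n => [//|n IH]; rewrite iintS (_ : (fun t => _) = cst 0).
  by rewrite Rintegral_cst// mul0r.
by apply/funext => t; rewrite IH.
Qed.

Lemma measurable_iint_section n (f : 'rV[R]_n.+1 -> R) :
  integrand f -> measurable_fun setT (fun t => iint (fun v => f (row_cons t v))).
Proof.
move=> [mf _]; apply: (@jmeas_iint _ _ _ (fun t v => f (row_cons t v))).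
exact: (jmeas_section (phi := id)).
Qed.

Lemma iint_section_support n M (f : 'rV[R]_n.+1 -> R) t : boxed M f ->
  iint (fun v => f (row_cons t v)) != 0 -> `|t| <= M.
Proof.
move=> fM; apply: contraNT => tM; rewrite (_ : (fun v => _) = fun=> 0) ?iint0//.
apply/funext => v; apply/eqP; apply: contraNT tM; exact: boxed_section0.
Qed.

(** Each integration runs over an interval of length [2 * M] and contributes that factor. *)
Lemma iint_le_box n M (f : 'rV[R]_n -> R) : 0 <= M ->
  jmeas (fun (_ : unit) v => f v) -> boxed M f -> `|iint f| <= M * (2 * M) ^+ n.
Proof.
move=> M0; elim: n f => [|n IH] f mf fM; first by rewrite expr0 mulr1; exact: (fM _).1.
rewrite iintS exprSr mulrA; apply: bounded_support_integral_le => //.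
- by apply: measurable_iint_section; split => //; exists M.
- move=> t; apply: IH; last exact: boxed_section.
  exact: (jmeas_section (phi := fun=> t)).
- by move=> t; exact: iint_section_support.
Qed.

Lemma iint_section_integrable n (f : 'rV[R]_n.+1 -> R) : integrand f ->
  mu.-integrable setT (EFin \o (fun t => iint (fun v => f (row_cons t v)))).
Proof.
move=> [mf [M M0 fM]].
apply: (@bounded_support_integrable _ _ M (M * (2 * M) ^+ n)).
- by apply: measurable_iint_section; split => //; exists M.
- move=> t; apply: iint_le_box => //; last exact: boxed_section.
  exact: (jmeas_section (phi := fun=> t)).
- by move=> t; exact: iint_section_support.
Qed.

Lemma integrandZ n (a : R) (f : 'rV[R]_n -> R) :
  integrand f -> integrand (fun v => a * f v).
Proof.
move=> [mf [M M0 fM]]; split; first by apply: jmeasM => //; exact: jmeas_cst.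
exists (`|a| * M + M); first by rewrite addr_ge0// mulr_ge0.
move=> v; have [f1 f2] := fM v; split.
  by rewrite normrM (le_trans (ler_wpM2l _ f1))// lerDl.
rewrite mulf_eq0 negb_or => /andP[_ /f2 h] i.
by rewrite (le_trans (h i))// lerDr mulr_ge0.
Qed.

Lemma iintD n (f g : 'rV[R]_n -> R) : integrand f -> integrand g ->
  iint (fun v => f v + g v) = iint f + iint g.
Proof.
elim: n f g => [//|n IH] f g If Ig; rewrite !iintS.
rewrite -RintegralD//; try exact: iint_section_integrable.
congr Rintegral; apply/funext => t.
by apply: (IH (fun v => f (row_cons t v)) (fun v => g (row_cons t v))); exact: integrand_section.
Qed.

Lemma iintZ n (a : R) (f : 'rV[R]_n -> R) : integrand f ->
  iint (fun v => a * f v) = a * iint f.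
Proof.
elim: n f => [//|n IH] f If; rewrite !iintS.
rewrite -RintegralZl//; last exact: iint_section_integrable.
congr Rintegral; apply/funext => t.
by apply: (IH (fun v => f (row_cons t v))); exact: integrand_section.
Qed.

Lemma iint_ge0 n (f : 'rV[R]_n -> R) : (forall v, 0 <= f v) -> 0 <= iint f.
Proof.
elim: n f => [//|n IH] f f0; first exact: f0.
by rewrite iintS; apply: Rintegral_ge0 => t _; exact: IH.
Qed.

Lemma iint_le n (f g : 'rV[R]_n -> R) : integrand f -> integrand g ->
  (forall v, f v <= g v) -> iint f <= iint g.
Proof.
move=> If Ig fg; rewrite -subr_ge0.
rewrite -[- iint f]mulN1r -iintZ// -iintD//; last exact: integrandZ.
by apply: iint_ge0 => v; rewrite mulN1r subr_ge0.
Qed.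

(** A small cube fitting inside the punctured unit ball; its volume bounds the total mass of the
    sphere from below. *)
Definition box_indic n (e : R) (v : 'rV[R]_n) : R :=
  \prod_(i < n) ((0 < v 0 i) && (v 0 i <= e))%:R.

Lemma box_indic_row_cons n e t (v : 'rV[R]_n) :
  box_indic e (row_cons t v) = ((0 < t) && (t <= e))%:R * box_indic e v.
Proof.
rewrite /box_indic big_ord_recl row_cons_0; congr (_ * _).
by apply: eq_bigr => i _; rewrite row_cons_lift.
Qed.

Lemma iint_box_indic n (e : R) : 0 < e -> iint (box_indic e : 'rV[R]_n -> R) = e ^+ n.
Proof.
move=> e0; elim: n => [|n IH]; first by rewrite /= /box_indic big_ord0 expr0.
rewrite iintS.
transitivity (Rintegral mu setT ((fun=> e ^+ n) \_ `]0, e]%classic)).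
  congr Rintegral; apply/funext => t.
  rewrite (_ : (fun v => _) = (fun v => ((0 < t) && (t <= e))%:R * box_indic e v)); last first.
    by apply/funext => v; rewrite box_indic_row_cons.
  rewrite /patch mem_setE in_itv /=; case: ifP => _.
    by rewrite -IH; congr iint; apply/funext => v; rewrite mul1r.
  transitivity (iint (fun _ : 'rV[R]_n => 0 : R)); last by rewrite iint0.
  by congr iint; apply/funext => v; rewrite mul0r.
rewrite -Rintegral_mkcond Rintegral_cst; last exact: measurable_itv.
rewrite exprSr; congr (_ * _).
have h : mu `]0, e]%classic = e%:E.
  by have := lebesgue_measure_itv `]0, e]; rewrite /= lte_fin e0 => ->; rewrite oppr0 adde0.
exact: (congr1 fine h).
Qed.

End IteratedIntegral.

(** * Linearity, positivity and total mass of the sphere integral *)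

Section SphereIntegral.
Variables (R : realType) (n : nat).
Implicit Types (g h : 'rV[R]_n -> R) (x v : 'rV[R]_n).

Definition normalize v : 'rV[R]_n := (Num.sqrt (dotp v v))^-1 *: v.

Definition ball_ext g v : R :=
  if (0 < dotp v v) && (dotp v v <= 1) then g (normalize v) else 0.

Lemma sintE g : sint g = n%:R * iint (ball_ext g).
Proof. by []. Qed.

Lemma dotpZ a b x v : dotp (a *: x) (b *: v) = a * b * dotp x v.
Proof. by rewrite /dotp mulr_sumr; apply: eq_bigr => i _; rewrite !mxE; ring. Qed.

Lemma on_sphere_normalize v : 0 < dotp v v -> on_sphere (normalize v).
Proof.
move=> v0; rewrite /on_sphere dotpZ -{3}[dotp v v]sqr_sqrtr ?(ltW v0)//.
by rewrite -expr2 -exprMn mulVf ?expr1n// gt_eqF// sqrtr_gt0.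
Qed.

Lemma on_sphere_coord x i : on_sphere x -> `|x 0 i| <= 1.
Proof.
rewrite /on_sphere /dotp (bigD1 i)//= => e.
rewrite -(@ler_pXn2r _ 2) ?nnegrE// expr1n real_normK ?num_real// expr2 -e lerDl.
by rewrite sumr_ge0// => j _; rewrite -expr2 sqr_ge0.
Qed.

Lemma dotp_le1_coord v i : dotp v v <= 1 -> `|v 0 i| <= 1.
Proof.
rewrite /dotp (bigD1 i)//= => e.
rewrite -(@ler_pXn2r _ 2) ?nnegrE// expr1n real_normK ?num_real// expr2.
apply: le_trans e; rewrite lerDl.
by rewrite sumr_ge0// => j _; rewrite -expr2 sqr_ge0.
Qed.

Lemma dotp_sphere_le1 x v : on_sphere x -> on_sphere v -> `|dotp x v| <= 1.
Proof.
rewrite /on_sphere => x1 v1.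
have h (e : R) : e ^+ 2 = 1 -> 0 <= 2 + 2 * e * dotp x v.
  move=> e1; have : 0 <= \sum_(i < n) (x 0 i + e * v 0 i) ^+ 2.
    by rewrite sumr_ge0// => i _; exact: sqr_ge0.
  rewrite (eq_bigr (fun i => x 0 i * x 0 i + v 0 i * v 0 i + 2 * e * (x 0 i * v 0 i))).
    by rewrite !big_split /= -mulr_sumr -/(dotp x x) -/(dotp v v) -/(dotp x v) x1 v1.
  by move=> i _; rewrite sqrrD exprMn e1 mul1r !expr2; ring.
have N1 : (-1) ^+ 2 = 1 :> R by rewrite sqrrN expr1n.
have := h 1 (expr1n _ _); have := h (-1) N1.
by rewrite ler_norml => ? ?; apply/andP; split; lra.
Qed.

Definition smeas g := jmeas (fun (_ : unit) v => g (normalize v)).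

(** Measurability concerns the radial extension of [g], and the bound only the sphere, because
    [ball_ext] evaluates [g] at normalized vectors only. *)
Definition sphere_fun g := smeas g /\ exists B : R, forall x, on_sphere x -> `|g x| <= B.

Lemma jmeas_dotp : jmeas (fun (_ : unit) v => dotp v v).
Proof. by apply: jmeas_sum => i; apply: jmeasM; exact: jmeas_coord. Qed.

Lemma measurable_sqrt : measurable_fun setT (@Num.sqrt R).
Proof. by apply: continuous_measurable_fun; exact: sqrt_continuous. Qed.

Lemma smeas_coord i : smeas (fun x => x 0 i).
Proof.
rewrite /smeas [X in jmeas X](_ : _ = fun (_ : unit) v => (Num.sqrt (dotp v v)) `^ (-1) * v 0 i).
  apply: jmeasM; last exact: jmeas_coord.
  apply: (@jmeas_comp1 _ _ _ _ (fun a => a `^ (-1)) (fun (_ : unit) v => Num.sqrt (dotp v v))).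
    exact: measurable_powR.
  by apply: jmeas_comp1; [exact: measurable_sqrt|exact: jmeas_dotp].
by apply/funext => u; apply/funext => v; rewrite mxE powR_inv1// sqrtr_ge0.
Qed.

Lemma sphere_fun_coord i : sphere_fun (fun x => x 0 i).
Proof.
split; first exact: smeas_coord.
by exists 1 => x; exact: on_sphere_coord.
Qed.

Lemma sphere_fun_cst a : sphere_fun (fun=> a).
Proof. by split; [exact: jmeas_cst|exists `|a|]. Qed.

Lemma sphere_funD g h : sphere_fun g -> sphere_fun h -> sphere_fun (fun x => g x + h x).
Proof.
move=> [mg [B gB]] [mh [C hC]]; split; first exact: jmeasD.
by exists (B + C) => x sx; rewrite (le_trans (ler_normD _ _))// lerD ?gB ?hC.
Qed.

Lemma sphere_funM g h : sphere_fun g -> sphere_fun h -> sphere_fun (fun x => g x * h x).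
Proof.
move=> [mg [B gB]] [mh [C hC]]; split; first exact: jmeasM.
by exists (B * C) => x sx; rewrite normrM ler_pM ?gB ?hC.
Qed.

Lemma sphere_funZ a g : sphere_fun g -> sphere_fun (fun x => a * g x).
Proof. by move=> gs; apply: sphere_funM => //; exact: sphere_fun_cst. Qed.

Lemma ball_ext_integrand g : sphere_fun g -> integrand (ball_ext g).
Proof.
move=> [mg [B gB]]; split.
  rewrite /ball_ext; apply: (@jmeas_comp2 _ _ _ _ (fun a b => if (0 < a) && (a <= 1) then b else 0)
    (fun (_ : unit) v => dotp v v) (fun (_ : unit) v => g (normalize v))) => //; last exact: jmeas_dotp.
  apply: (@measurable_fun_ifT _ _ _ R (fun p : R * R => p.2) (fun=> 0)
    (fun p => (0 < p.1) && (p.1 <= 1))); [|exact: measurable_snd|exact: measurable_cst].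
  apply: measurable_and.
    by apply: measurable_fun_ltr => //; exact: measurable_fst.
  by apply: measurable_fun_ler => //; exact: measurable_fst.
(* [|B|] takes care of the values, 1 of the support, which lies in the unit ball. *)
exists (`|B| + 1); first by rewrite addr_ge0.
move=> v; rewrite /ball_ext; case: ifPn => [/andP[v0 v1]|_]; last first.
  by rewrite normr0 eqxx addr_ge0.
split.
  by rewrite (le_trans (gB _ (on_sphere_normalize v0)))// ler_wpDr// ler_norm.
by move=> _ i; rewrite (le_trans (dotp_le1_coord i v1))// lerDr.
Qed.

Lemma eq_sint g h : (forall x, on_sphere x -> g x = h x) -> sint g = sint h.
Proof.
move=> gh; rewrite !sintE; congr (_ * iint _); apply/funext => v.
by rewrite /ball_ext; case: ifPn => // /andP[v0 _]; rewrite gh//; exact: on_sphere_normalize.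
Qed.

Lemma sintD g h : sphere_fun g -> sphere_fun h ->
  sint (fun x => g x + h x) = sint g + sint h.
Proof.
move=> sg sh; rewrite !sintE -mulrDr -iintD; try exact: ball_ext_integrand.
congr (_ * iint _); apply/funext => v; rewrite /ball_ext.
by case: ifP => // _; rewrite addr0.
Qed.

Lemma sintZ a g : sphere_fun g -> sint (fun x => a * g x) = a * sint g.
Proof.
move=> sg; rewrite !sintE mulrCA; congr (_ * _).
rewrite -iintZ; last exact: ball_ext_integrand.
congr iint; apply/funext => v; rewrite /ball_ext.
by case: ifP => // _; rewrite mulr0.
Qed.

Lemma sint_ge0 g : (forall x, on_sphere x -> 0 <= g x) -> 0 <= sint g.
Proof.
move=> g0; rewrite sintE mulr_ge0//; apply: iint_ge0 => v; rewrite /ball_ext.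
by case: ifPn => // /andP[v0 _]; exact/g0/on_sphere_normalize.
Qed.

(** Positivity of the integral, applied to [B + g] and [B - g]. *)
Lemma sint_norm_le g B : sphere_fun g -> (forall x, on_sphere x -> `|g x| <= B) ->
  `|sint g| <= B * sint (fun _ : 'rV[R]_n => 1).
Proof.
move=> sg gB; have s1 : sphere_fun (fun=> 1) by exact: sphere_fun_cst.
have h (e : R) : (forall x, on_sphere x -> 0 <= B + e * g x) ->
    0 <= B * sint (fun _ : 'rV[R]_n => 1) + e * sint g.
  move=> hB; rewrite -!sintZ// -sintD; try exact: sphere_funZ.
  by apply: sint_ge0 => x sx; rewrite mulr1 hB.
rewrite ler_norml; apply/andP; split.
  rewrite -subr_ge0 opprK addrC -[sint g]mul1r; apply: h => x sx.
  by have := gB x sx; rewrite ler_norml mul1r => /andP[]; lra.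
rewrite -subr_ge0 -mulN1r; apply: h => x sx.
by have := gB x sx; rewrite ler_norml mulN1r => /andP[]; lra.
Qed.

Lemma sint1_gt0 : (0 < n)%N -> 0 < sint (fun _ : 'rV[R]_n => 1).
Proof.
move=> n0; rewrite sintE mulr_gt0 ?ltr0n//.
(* In the cube of side [1 / n] each squared coordinate is at most [1 / n], so the squared norm is at
   most 1. *)
pose e : R := n%:R^-1; have e0 : 0 < e by rewrite invr_gt0 ltr0n.
have e1 : e <= 1 by rewrite invf_le1 ?ler1n ?ltr0n.
apply: (@lt_le_trans _ _ (iint (box_indic e : 'rV[R]_n -> R))).
  by rewrite iint_box_indic// exprn_gt0.
apply: iint_le.
- split.
    apply: jmeas_prod => i.
    apply: (@jmeas_comp1 _ _ _ _ (fun a => ((0 < a) && (a <= e))%:R)); last exact: jmeas_coord.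
    rewrite [X in measurable_fun _ X](_ : _ = fun a : R => if (0 < a) && (a <= e) then 1 else 0).
      apply: measurable_fun_ifT => //; apply: measurable_and.
        exact: measurable_fun_ltr.
      exact: measurable_fun_ler.
    by apply/funext => a; case: ifP.
  exists 1 => // v; rewrite /box_indic.
  case: (boolP [forall i, (0 < v 0 i) && (v 0 i <= e)]) => [/forallP H|].
    rewrite big1; last by move=> i _; rewrite H.
    rewrite normr1; split=> // _ i; have /andP[h1 h2] := H i.
    by rewrite ger0_norm ?(le_trans h2)// ltW.
  rewrite negb_forall => /existsP[i /negPf Hi].
  by rewrite (bigD1 i)//= Hi mul0r normr0 eqxx.
- by apply: ball_ext_integrand; exact: sphere_fun_cst.
- move=> v; rewrite /box_indic /ball_ext.
  case: (boolP [forall i, (0 < v 0 i) && (v 0 i <= e)]) => [/forallP H|]; last first.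
    rewrite negb_forall => /existsP[i /negPf Hi].
    by rewrite (bigD1 i)//= Hi mul0r; case: ifP.
  rewrite big1; last by move=> i _; rewrite H.
  rewrite ifT//; apply/andP; split.
    rewrite /dotp (bigD1 (Ordinal n0))//= ltr_pwDl//.
      by have /andP[h _] := H (Ordinal n0); rewrite mulr_gt0.
    by rewrite sumr_ge0// => i _; rewrite -expr2 sqr_ge0.
  apply: (@le_trans _ _ (\sum_(i < n) e)).
    apply: ler_sum => i _; have /andP[h1 h2] := H i.
    by rewrite -[leRHS]mulr1 ler_pM ?(le_trans h2)// ltW.
  by rewrite sumr_const card_ord -mulr_natr /e mulVf// pnatr_eq0 -lt0n.
Qed.

End SphereIntegral.

(** * Invariance under rotations of two consecutive coordinates *)

Section PlaneRotation.
Variable R : realType.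
Local Notation mu := (@lebesgue_measure R).

Definition rotv n (p q : 'I_n) (c s : R) (v : 'rV[R]_n) : 'rV[R]_n :=
  \row_j (if j == p then c * v 0 p - s * v 0 q
          else if j == q then s * v 0 p + c * v 0 q else v 0 j).

Lemma rotvZ n (p q : 'I_n) c s a (v : 'rV[R]_n) :
  rotv p q c s (a *: v) = a *: rotv p q c s v.
Proof.
by apply/rowP => j; rewrite !mxE; case: ifP => _; [|case: ifP => _ //]; ring.
Qed.

Lemma dotp_rotv n (p q : 'I_n) c s (v : 'rV[R]_n) : p != q -> c ^+ 2 + s ^+ 2 = 1 ->
  dotp (rotv p q c s v) (rotv p q c s v) = dotp v v.
Proof.
move=> pq cs; rewrite /dotp (bigD1 p)//= (bigD1 q) 1?eq_sym//=.
rewrite [in RHS](bigD1 p)//= [in RHS](bigD1 q) 1?eq_sym//=.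
rewrite !mxE !eqxx eq_sym (negPf pq) !addrA; congr (_ + _).
  have -> : v 0 p * v 0 p + v 0 q * v 0 q = (c ^+ 2 + s ^+ 2) * (v 0 p * v 0 p + v 0 q * v 0 q).
    by rewrite cs mul1r.
  by ring.
by apply: eq_bigr => j /andP[jp jq]; rewrite !mxE (negPf jp) (negPf jq).
Qed.

Lemma planar_iint n (f : 'rV[R]_n.+2 -> R) : integrand f ->
  planar (fun s t => iint (fun v => f (row_cons s (row_cons t v)))).
Proof.
move=> [mf [M M0 fM]]; split.
  apply: (@jmeas_iint _ _ _ _ (fun (p : R * R) v => f (row_cons p.1 (row_cons p.2 v)))).
  apply: (jmeas_subst (phi := fun p : R * R => ((tt, p.1), p.2)) _ mf).
  apply: measurable_fun_pair; last exact: measurable_snd.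
  by apply: measurable_fun_pair; [exact: measurable_cst|exact: measurable_fst].
have K0 : 0 <= M * (2 * M) ^+ n by rewrite mulr_ge0// exprn_ge0// mulr_ge0.
exists (M + M * (2 * M) ^+ n); first by rewrite addr_ge0.
move=> s t; split.
  apply: (@le_trans _ _ (M * (2 * M) ^+ n)); last by rewrite lerDr.
  have [m1 b1] : integrand (fun v => f (row_cons s (row_cons t v))).
    by apply: (@integrand_section _ _ (fun v => f (row_cons s v))); apply: integrand_section;
      split => //; exists M.
  by apply: iint_le_box => //; exact: (boxed_section t (boxed_section s fM)).
move=> h; suff: `|s| <= M /\ `|t| <= M.
  by move=> [? ?]; split; apply: le_trans (_ : M <= _) => //; rewrite lerDl.
have {h}[v hv] : exists v, f (row_cons s (row_cons t v)) != 0.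
  apply: contrapT => /forallNP hv; move/negP: h; apply; apply/eqP.
  rewrite -[RHS](iint0 R n); congr iint; apply/funext => v; apply/eqP.
  exact/negPn/negP/hv.
have := (fM _).2 hv => h; split.
  by have := h ord0; rewrite row_cons_0.
by have := h (lift ord0 ord0); rewrite row_cons_lift row_cons_0.
Qed.

(** Coordinates before [p] are fixed by the rotation and are peeled off by induction, until [p] and
    [q] are the two outermost integration variables. The inner integral is then a planar function,
    and [pint_rot] applies. *)
Lemma iint_rotv n (p q : 'I_n) c s (f : 'rV[R]_n -> R) :
  q = p.+1 :> nat -> s != 0 -> c ^+ 2 + s ^+ 2 = 1 -> integrand f ->
  iint (fun v => f (rotv p q c s v)) = iint f.
Proof.
move=> + s0 cs; elim: n p q f => [|n IH] p q f; first by case: p.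
case: (unliftP ord0 p) => [p' ->|->]; case: (unliftP ord0 q) => [q' ->|->] // /eqP.
  rewrite !lift0 eqSS => /eqP qp If; rewrite !iintS; congr Rintegral.
  apply/funext => t; rewrite -(IH p' q' _ qp (integrand_section t If)).
  congr iint; apply/funext => v; congr f; apply/rowP => j; rewrite mxE.
  case: (unliftP ord0 j) => [j' ->|->]; last by rewrite !row_cons_0.
  by rewrite !row_cons_lift mxE !(inj_eq lift_inj).
rewrite lift0 eqSS => /eqP q0.
case: n IH p q f q' q0 => [|n] IH p q f q' q0; first by case: (q').
have {q0}-> : q' = ord0 by exact/val_inj.
move=> If.
rewrite -[RHS]/(pint (fun s t => iint (fun v => f (row_cons s (row_cons t v))))).
rewrite -(pint_rot s0 cs (planar_iint If)) !iintS /pint; congr Rintegral.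
apply/funext => x; rewrite iintS; congr Rintegral; apply/funext => y.
congr iint; apply/funext => v; congr f; apply/rowP => j; rewrite mxE.
rewrite !row_cons_lift !row_cons_0.
case: (unliftP ord0 j) => [j' ->|->]; last by rewrite eqxx row_cons_0.
rewrite !row_cons_lift (inj_eq lift_inj) /=.
by case: (unliftP ord0 j') => [k ->|->]; rewrite ?eqxx ?row_cons_lift ?row_cons_0.
Qed.

Lemma ball_ext_rotv n (g : 'rV[R]_n -> R) (p q : 'I_n) c s :
  p != q -> c ^+ 2 + s ^+ 2 = 1 ->
  ball_ext (fun x => g (rotv p q c s x)) = fun v => ball_ext g (rotv p q c s v).
Proof.
move=> pq cs; apply/funext => v; rewrite /ball_ext dotp_rotv//.
by case: ifP => // _; rewrite /normalize dotp_rotv// rotvZ.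
Qed.

Lemma sint_rotv n (g : 'rV[R]_n -> R) (p q : 'I_n) c s :
  q = p.+1 :> nat -> s != 0 -> c ^+ 2 + s ^+ 2 = 1 -> sphere_fun g ->
  sint (fun x => g (rotv p q c s x)) = sint g.
Proof.
move=> qp s0 cs sg; have pq : p != q by rewrite -val_eqE /= qp neq_ltn ltnSn.
rewrite !sintE ball_ext_rotv// iint_rotv//; exact: ball_ext_integrand.
Qed.

End PlaneRotation.

(** * Infinitesimal rotations, the Laplacian and harmonic decomposition of polynomials *)

Section PolynomialCalculus.
Variables (R : realType) (n : nat).
Local Notation P := {mpoly R[n]}.
Implicit Types (f g h : P) (i j : 'I_n) (x : 'rV[R]_n).

Lemma mpoly_alg_ind (Q : P -> Prop) :
  (forall c : R, Q c%:MP) -> (forall i, Q 'X_i) ->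
  (forall f g, Q f -> Q g -> Q (f + g)) -> (forall f g, Q f -> Q g -> Q (f * g)) ->
  forall f, Q f.
Proof.
move=> QC QX QD QM f; rewrite (mpolyE f).
apply: (big_ind Q) => [|//|m _]; first by rewrite -[0]/(0%:MP : P).
rewrite -mul_mpolyC; apply: (QM) => //; rewrite mpolyXE_id.
apply: (big_ind Q) => [|//|i _]; first by rewrite -[1]/(1%:MP : P).
elim: (m i) => [|k IH]; first by rewrite expr0 -[1]/(1%:MP : P).
by rewrite exprS; exact: QM.
Qed.

Lemma pevalD f g x : peval (f + g) x = peval f x + peval g x.
Proof. exact: mevalD. Qed.
Lemma pevalB f g x : peval (f - g) x = peval f x - peval g x.
Proof. exact: mevalB. Qed.
Lemma pevalM f g x : peval (f * g) x = peval f x * peval g x.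
Proof. exact: mevalM. Qed.
Lemma pevalZ a f x : peval (a *: f) x = a * peval f x.
Proof. exact: mevalZ. Qed.
Lemma pevalC a x : peval (a%:MP : P) x = a.
Proof. exact: mevalC. Qed.
Lemma peval0 x : peval (0 : P) x = 0.
Proof. exact: meval0. Qed.
Lemma pevalX i x : peval ('X_i : P) x = x 0 i.
Proof. exact: mevalXU. Qed.
Lemma peval_sum (I : Type) (r : seq I) (S : pred I) (F : I -> P) x :
  peval (\sum_(i <- r | S i) F i) x = \sum_(i <- r | S i) peval (F i) x.
Proof. exact: (raddf_sum (meval (fun i => x 0 i))). Qed.
Lemma pevalXn f k x : peval (f ^+ k) x = peval f x ^+ k.
Proof. exact: (rmorphXn (meval (fun i => x 0 i))). Qed.

Lemma mderivXU i j : ('X_j : P)^`M(i) = if j == i then 1 else 0.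
Proof.
rewrite mderivX mnm1E; case: eqP => [->|_]; last by rewrite scale0r.
rewrite mulr1n scale1r (_ : (_ - _)%MM = 0%MM) ?mpolyX0//.
by apply/mnmP => k; rewrite mnmBE mnm0E subnn.
Qed.

Lemma mderivXn f k i : (f ^+ k)^`M(i) = k%:R *: (f ^+ k.-1 * f^`M(i)).
Proof.
elim: k => [|k IH]; first by rewrite expr0 -mpolyC1 mderivC scale0r.
rewrite exprS mderivM IH /=; case: k {IH} => [|k].
  by rewrite !expr0 scale0r mulr0 addr0 mulr1 scale1r mul1r.
by rewrite /= -scalerAr mulrA -exprS -[in RHS]natr1 scalerDl scale1r mulrC addrC.
Qed.

Lemma mderiv_sum (I : Type) (r : seq I) (F : I -> P) i :
  (\sum_(j <- r) F j)^`M(i) = \sum_(j <- r) (F j)^`M(i).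
Proof. exact: (raddf_sum (mderiv i)). Qed.

Lemma dhomog_XU i : ('X_i : P) \is 1.-homog.
Proof. by rewrite dhomogX; apply/eqP; exact: mdeg1. Qed.

(** The generator of [rotv p q]: the first-order coefficient in [s] of [f] composed with the
    rotation. *)
Definition drot p q f : P := 'X_p * f^`M(q) - 'X_q * f^`M(p).

Lemma drotD p q f g : drot p q (f + g) = drot p q f + drot p q g.
Proof. by rewrite /drot !mderivD; ring. Qed.

Lemma drotM p q f g : drot p q (f * g) = drot p q f * g + f * drot p q g.
Proof. by rewrite /drot !mderivM; ring. Qed.

Lemma drotC p q c : drot p q c%:MP = 0.
Proof. by rewrite /drot !mderivC !mulr0 subrr. Qed.

Lemma drotN p q f : drot q p f = - drot p q f.
Proof. by rewrite /drot; ring. Qed.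

(** The bracket relation of the rotation algebra; it reaches non-consecutive pairs of
    coordinates. *)
Lemma drot_comm p q r f : p != q -> q != r -> p != r ->
  drot p r f = drot p q (drot q r f) - drot q r (drot p q f).
Proof.
move=> pq qr pr; rewrite /drot !mderivB !mderivM !mderivXU !eqxx.
rewrite !(eq_sym q p) !(eq_sym r p) !(eq_sym r q).
rewrite !(negPf pq) !(negPf qr) !(negPf pr).
by rewrite (mderiv_comm q r) (mderiv_comm p r) (mderiv_comm q p); ring.
Qed.

Definition sqnorm : P := \sum_(i < n) 'X_i * 'X_i.

Definition euler f : P := \sum_(i < n) 'X_i * f^`M(i).

Lemma peval_sqnorm x : peval sqnorm x = dotp x x.
Proof. by rewrite peval_sum; apply: eq_bigr => i _; rewrite pevalM !pevalX. Qed.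

(** The last term corrects the diagonal [p = q], where [drot] vanishes, so that sums may run over
    all pairs. *)
Lemma drot2 p q f : drot p q (drot p q f) =
  'X_p * 'X_p * f^`M(q)^`M(q) + 'X_q * 'X_q * f^`M(p)^`M(p)
  - 2%:R * ('X_q * ('X_p * f^`M(q)^`M(p)))
  - ('X_p * f^`M(p) + 'X_q * f^`M(q))
  + (if p == q then 'X_p * f^`M(q) + 'X_q * f^`M(p) else 0).
Proof.
rewrite /drot !mderivB !mderivM !mderivXU !eqxx (mderiv_comm p q) (eq_sym q p).
by case: (p == q); ring.
Qed.

Lemma laplacianE f : laplacian f = \sum_(i < n) f^`M(i)^`M(i).
Proof. by []. Qed.

Lemma sum_drot2 f : \sum_(p < n) \sum_(q < n) drot p q (drot p q f) =
  2%:R * (sqnorm * laplacian f - \sum_(q < n) 'X_q * euler (f^`M(q))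
          - n%:R * euler f + euler f).
Proof.
have e1 : \sum_(p < n) \sum_(q < n) ('X_p * 'X_p * f^`M(q)^`M(q)) = sqnorm * laplacian f.
  by rewrite mulr_suml; apply: eq_bigr => p _; rewrite mulr_sumr.
have e2 : \sum_(p < n) \sum_(q < n) ('X_q * 'X_q * f^`M(p)^`M(p)) = sqnorm * laplacian f.
  by rewrite exchange_big.
have e3 : \sum_(p < n) \sum_(q < n) ('X_q * ('X_p * f^`M(q)^`M(p))) =
   \sum_(q < n) 'X_q * euler (f^`M(q)).
  by rewrite exchange_big; apply: eq_bigr => q _; rewrite -mulr_sumr.
have e4 : \sum_(p < n) \sum_(q < n) ('X_p * f^`M(p)) = n%:R * euler f.
  rewrite mulr_sumr; apply: eq_bigr => p _.
  by rewrite sumr_const card_ord mulr_natl.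
have e5 : \sum_(p < n) \sum_(q < n) ('X_q * f^`M(q)) = n%:R * euler f.
  by rewrite exchange_big.
have e6 : \sum_(p < n) \sum_(q < n) (if p == q then 'X_p * f^`M(q) + 'X_q * f^`M(p) else 0) =
    2%:R * euler f.
  rewrite mulr_sumr; apply: eq_bigr => p _.
  rewrite (bigD1 p)//= eqxx big1; first by ring.
  by move=> q; rewrite eq_sym => /negPf ->.
transitivity (sqnorm * laplacian f + sqnorm * laplacian f
   - 2%:R * (\sum_(q < n) 'X_q * euler (f^`M(q))) - (n%:R * euler f + n%:R * euler f)
   + 2%:R * euler f); last by ring.
rewrite -{1}e1 -e2 -e3 -{1}e4 -e5 -e6 mulr_sumr -!big_split /= -!sumrB -big_split /=.
apply: eq_bigr => p _; rewrite mulr_sumr -!big_split /= -!sumrB -big_split /=.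
by apply: eq_bigr => q _; rewrite drot2.
Qed.

Lemma dhomog_mderiv f m i : f \is m.-homog -> f^`M(i) \is m.-1.-homog.
Proof.
move=> /dhomogP hf; apply/dhomogP => mm; rewrite mcoeff_msupp mcoeff_mderiv => h.
have : (mm + U_(i))%MM \in msupp f.
  by rewrite mcoeff_msupp; apply: contraNneq h => ->; rewrite mul0rn.
move=> h'; have <- : mdeg (mm + U_(i))%MM = m := hf _ h'.
by rewrite mdegD mdeg1 addn1.
Qed.

(** Euler's identity, checked monomial by monomial. *)
Lemma euler_homog f m : f \is m.-homog -> euler f = m%:R *: f.
Proof.
move=> /dhomogP hf; rewrite [in RHS](mpolyE f) scaler_sumr {1}(mpolyE f).
rewrite /euler.
under eq_bigr do rewrite mderiv_sum mulr_sumr.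
rewrite exchange_big /= big_seq [RHS]big_seq; apply: eq_bigr => mm hmm.
have <- : mdeg mm = m := hf _ hmm.
rewrite mdegE natr_sum scaler_suml; apply: eq_bigr => i _.
rewrite mderivZ mderivX -!scalerAr !scalerA mulrC.
have [->|mi0] := eqVneq (mm i) 0%N; first by rewrite mul0r !scale0r.
congr (_ *: _); rewrite -mpolyXD; congr mpolyX; apply/mnmP => j.
rewrite mnmDE mnmBE mnm1E; case: eqP => [<-|_]; last by rewrite add0n subn0.
by rewrite addnC subnK// lt0n.
Qed.

Lemma dhomog0_C f : f \is 0.-homog -> f = (f@_0)%:MP.
Proof.
move=> /dhomogP hf; apply/mpolyP => m; rewrite mcoeffC.
have [->|m0] := eqVneq m 0%MM; first by rewrite mulr1.
rewrite mulr0; apply/eqP; rewrite -[_ == 0]negbK -mcoeff_msupp.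
apply/negP => hm; have e : mdeg m = 0%N := hf _ hm.
by move: m0; rewrite -mdeg_eq0 e eqxx.
Qed.

Lemma laplacian_homog f m : f \is m.-homog -> laplacian f \is m.-2.-homog.
Proof.
move=> hf; rewrite laplacianE; apply: rpred_sum => i _.
exact: (dhomog_mderiv i (dhomog_mderiv i hf)).
Qed.

Lemma mderiv_homog0 f i : f \is 0.-homog -> f^`M(i) = 0.
Proof. by move=> /dhomog0_C ->; rewrite mderivC. Qed.

Lemma laplacian_homog_lt2 f m : (m < 2)%N -> f \is m.-homog -> laplacian f = 0.
Proof.
case: m => [|[|]]// _ hf; rewrite laplacianE big1// => i _.
  by rewrite (mderiv_homog0 i hf) mderiv0.
exact/mderiv_homog0/(dhomog_mderiv i hf).
Qed.

(* Up to the factor 2 (each pair is counted twice), the sum of the squares of the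
   infinitesimal rotations is the spherical Laplacian. *)
Lemma casimir f m : f \is m.-homog -> \sum_(p < n) \sum_(q < n) drot p q (drot p q f) =
  2%:R *: (sqnorm * laplacian f - (m%:R * (m%:R + n%:R - 2)) *: f).
Proof.
move=> hf; rewrite sum_drot2.
have -> : \sum_(q < n) 'X_q * euler (f^`M(q)) = (m%:R * (m%:R - 1)) *: f.
  have -> : m%:R * (m%:R - 1) = m.-1%:R * m%:R :> R.
    by case: (m) => [|k]; rewrite ?mulr0 ?mul0r// -[k.+1%:R]natr1 /=; ring.
  rewrite -scalerA -(euler_homog hf) scaler_sumr; apply: eq_bigr => q _.
  by rewrite (euler_homog (dhomog_mderiv q hf)) scalerAr.
rewrite (euler_homog hf) -!mul_mpolyC !mpolyC_nat; rewrite !(mpolyCM, mpolyCB, mpolyCD) !mpolyC_nat.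
by rewrite mpolyC1; ring.
Qed.

Lemma laplacianD f g : laplacian (f + g) = laplacian f + laplacian g.
Proof. by rewrite !laplacianE -big_split; apply: eq_bigr => i _; rewrite !mderivD. Qed.

Lemma laplacianZ a f : laplacian (a *: f) = a *: laplacian f.
Proof. by rewrite !laplacianE scaler_sumr; apply: eq_bigr => i _; rewrite !mderivZ. Qed.

Lemma laplacian0 : laplacian (0 : P) = 0.
Proof. by rewrite laplacianE big1// => i _; rewrite !mderiv0. Qed.

Lemma laplacianM f g : laplacian (f * g) =
  laplacian f * g + 2%:R * (\sum_(i < n) f^`M(i) * g^`M(i)) + f * laplacian g.
Proof.
rewrite !laplacianE mulr_suml !mulr_sumr -!big_split /=; apply: eq_bigr => i _.
by rewrite !(mderivM, mderivD); ring.
Qed.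

Lemma mderiv_sqnorm i : sqnorm^`M(i) = 2%:R * 'X_i.
Proof.
rewrite mderiv_sum (bigD1 i)//= big1 => [|j ji]; rewrite mderivM mderivXU.
  by rewrite eqxx; ring.
by rewrite (negPf ji); ring.
Qed.

(** The commutator of the Laplacian with multiplication by the squared norm is [2n + 4 * euler], a
    positive scalar on homogeneous polynomials when [n > 0]; this drives both the solver and the
    decomposition below. *)
Lemma laplacian_sqnormM g m : g \is m.-homog ->
  laplacian (sqnorm * g) = (2 * n%:R + 4 * m%:R) *: g + sqnorm * laplacian g.
Proof.
move=> hg; rewrite laplacianM.
have -> : laplacian sqnorm = (2 * n%:R) *: 1.
  rewrite laplacianE (eq_bigr (fun=> 2%:R)) => [|i _].
    by rewrite sumr_const card_ord -mul_mpolyC mpolyCM !mpolyC_nat mulr1 mulr_natr.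
  by rewrite mderiv_sqnorm mderivM mderivXU eqxx -mpolyC_nat mderivC; ring.
have -> : \sum_(i < n) sqnorm^`M(i) * g^`M(i) = 2%:R * euler g.
  by rewrite mulr_sumr; apply: eq_bigr => i _; rewrite mderiv_sqnorm mulrA.
rewrite (euler_homog hg) -!mul_mpolyC !(mpolyCM, mpolyCD) !mpolyC_nat.
by ring.
Qed.

Lemma sqnorm_homog : sqnorm \is 2.-homog.
Proof.
apply: rpred_sum => i _; apply: (@dhomogM _ _ _ 1 _ 1); exact: dhomog_XU.
Qed.

Lemma harm_homogE k f : harm_homog k f <-> (f \is k.-homog) /\ laplacian f = 0.
Proof. by rewrite /harm_homog dhomogE. Qed.

(* [sqnorm * laplacian] has nonnegative spectrum, so adding a positive scalar
   makes it invertible; a solution is built by descent on the degree. *)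
Lemma laplacian_solve (m : nat) (a : R) g : 0 < a -> g \is m.-homog ->
  exists2 f, f \is m.-homog & a *: f + sqnorm * laplacian f = g.
Proof.
have [k] := ubnP m; elim: k m a g => // k IH j a g jk a0 hg.
have [j2|j2] := ltnP j 2.
  exists (a^-1 *: g); first exact: dhomogZ.
  rewrite laplacianZ (laplacian_homog_lt2 j2 hg) scaler0 mulr0 addr0.
  by rewrite scalerA divff ?scale1r// gt_eqF.
case: j j2 jk hg => [|[|j]]// _ jk hg.
have b0 : 0 < a + (2 * n%:R + 4 * j%:R) by rewrite ltr_wpDr// addr_ge0// mulr_ge0.
(* Applying the Laplacian to the equation shows that [y = laplacian f] must solve the same kind of
   equation two degrees lower, with [a] increased by [2n + 4j]. *)
have [y hy ey] := IH j _ _ (ltn_trans (ltnSn _) jk) b0 (laplacian_homog hg).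
exists (a^-1 *: (g - sqnorm * y)).
  apply/dhomogZ/dhomogD; first exact: hg.
  by rewrite dhomogN -[j.+2]/(2 + j)%N; apply: dhomogM => //; exact: sqnorm_homog.
rewrite scalerA divff ?gt_eqF// scale1r laplacianZ -scalerAr.
have -> : laplacian (g - sqnorm * y) = a *: y.
  rewrite -[- (sqnorm * y)]scaleN1r laplacianD laplacianZ (laplacian_sqnormM hy) -ey.
  set t := 2 * n%:R + 4 * j%:R; set S := sqnorm * _.
  by rewrite scaleN1r (scalerDl y a t) -[a *: y + t *: y + S]addrA addrK.
by rewrite scalerAr scalerA mulVf ?gt_eqF// scale1r subrK.
Qed.

Lemma harmonic_decomposition m g : (0 < n)%N -> g \is m.-homog ->
  exists h : nat -> P, (forall k, harm_homog k (h k)) /\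
    forall x, on_sphere x -> peval g x = \sum_(k < m.+1) peval (h k) x.
Proof.
move=> n0; have [k] := ubnP m; elim: k m g => // k IH m g mk hg.
have harm0 l : harm_homog l (0 : P).
  by apply/harm_homogE; split; [exact: dhomog0|exact: laplacian0].
have [m2|m2] := ltnP m 2.
  exists (fun l => if l == m then g else 0); split.
    move=> l; case: eqP => [->|_]//; apply/harm_homogE; split => //.
    exact: laplacian_homog_lt2 hg.
  move=> x _; rewrite big_ord_recr /= eqxx big1 ?add0r// => i _.
  by rewrite ltn_eqF ?peval0.
case: m m2 mk hg => [|[|m]]// _ mk hg.
have b0 : 0 < 2 * n%:R + 4 * m%:R :> R by rewrite ltr_pwDl ?mulr_gt0 ?ltr0n// mulr_ge0.
(* With this scalar the equation says that [sqnorm * y] and [g] have the same Laplacian. Their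
   difference is the harmonic top component, and on the sphere [sqnorm * y] is just [y]. *)
have [y hy ey] := laplacian_solve b0 (laplacian_homog hg).
have [h [hh eh]] := IH m y (ltn_trans (ltnSn _) mk) hy.
exists (fun l => if l == m.+2 then g - sqnorm * y else if (l <= m)%N then h l else 0); split.
  move=> l; case: eqP => [->|_]; last by case: ifP.
  apply/harm_homogE; split.
    apply/dhomogD; first exact: hg.
    by rewrite dhomogN -[m.+2]/(2 + m)%N; apply: dhomogM => //; exact: sqnorm_homog.
  by rewrite -[- (sqnorm * y)]scaleN1r laplacianD laplacianZ (laplacian_sqnormM hy) ey scaleN1r subrr.
move=> x sx; rewrite 2!big_ord_recr /= eqxx pevalB pevalM peval_sqnorm sx mul1r.
rewrite (ltn_eqF (ltnSn m.+1)) ltnn peval0 addr0 (eh x sx) addrC -addrA.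
rewrite (eq_bigr (fun i : 'I_m.+1 => peval (h i) x)) ?subrK//.
  by rewrite addNr addr0.
move=> i _; have := ltn_ord i; rewrite ltnS => im.
by rewrite im ltn_eqF// (leq_ltn_trans im).
Qed.

Definition linform x : P := \sum_(i < n) x 0 i *: 'X_i.

Definition dirderiv x f : P := \sum_(i < n) x 0 i *: f^`M(i).

Lemma peval_linform x z : peval (linform x) z = dotp x z.
Proof. by rewrite peval_sum; apply: eq_bigr => i _; rewrite pevalZ pevalX. Qed.

Lemma linform_homog x : linform x \is 1.-homog.
Proof. by apply: rpred_sum => i _; apply: dhomogZ; exact: dhomog_XU. Qed.

Lemma mderiv_linform x i : (linform x)^`M(i) = (x 0 i)%:MP.
Proof.
rewrite mderiv_sum (bigD1 i)//= big1 => [|j ji]; rewrite mderivZ mderivXU.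
  by rewrite eqxx addr0 -mul_mpolyC mulr1.
by rewrite (negPf ji) scaler0.
Qed.

(** The gradient of [linform x] is the constant vector [x], of norm 1, and its Laplacian is zero. *)
Lemma laplacian_linformX x k f : on_sphere x -> laplacian (linform x ^+ k * f) =
  (k%:R * (k%:R - 1)) *: (linform x ^+ k.-2 * f) +
  (2 * k%:R) *: (linform x ^+ k.-1 * dirderiv x f) + linform x ^+ k * laplacian f.
Proof.
move=> sx; rewrite laplacianM; congr (_ + _ + _).
  rewrite scalerAl; congr (_ * _); rewrite laplacianE.
  rewrite (eq_bigr (fun i => (k%:R * (k%:R - 1)) *: (linform x ^+ k.-2 * (x 0 i * x 0 i)%:MP))).
    by rewrite -scaler_sumr -mulr_sumr -(raddf_sum (@mpolyC n R)) -/(dotp x x) sx mulr1.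
  move=> i _; rewrite mderivXn mderiv_linform mderivZ mderivM mderivC mulr0 addr0.
  rewrite mderivXn mderiv_linform -!scalerAl !scalerA -mulrA -mpolyCM.
  congr (_ *: _); case: k => [|k]; first by rewrite !mul0r.
  by rewrite /= -[k.+1%:R]natr1 addrK.
rewrite /dirderiv !mulr_sumr scaler_sumr; apply: eq_bigr => i _.
by rewrite mderivXn mderiv_linform -!mul_mpolyC !mpolyCM mpolyC_nat; ring.
Qed.

Lemma mderiv_dirderiv x f j : (dirderiv x f)^`M(j) = dirderiv x (f^`M(j)).
Proof.
rewrite /dirderiv mderiv_sum; apply: eq_bigr => i _.
by rewrite mderivZ (mderiv_comm i j).
Qed.

Lemma dirderiv_harm x f k : harm_homog k f -> harm_homog k.-1 (dirderiv x f).
Proof.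
move=> /harm_homogE[hf lf]; apply/harm_homogE; split.
  by apply: rpred_sum => i _; apply/dhomogZ/dhomog_mderiv.
rewrite (_ : laplacian _ = dirderiv x (laplacian f)).
  by rewrite lf /dirderiv big1// => i _; rewrite mderiv0 scaler0.
rewrite laplacianE (eq_bigr (fun j => dirderiv x (f^`M(j)^`M(j)))); last first.
  by move=> j _; rewrite !mderiv_dirderiv.
rewrite /dirderiv exchange_big /=; apply: eq_bigr => i _.
by rewrite laplacianE mderiv_sum scaler_sumr.
Qed.

(** At [x] itself the derivative in direction [x] is the Euler operator; this lets the recursion for
    the eigenvalues close on the value at [x]. *)
Lemma peval_dirderiv x f k : f \is k.-homog -> peval (dirderiv x f) x = k%:R * peval f x.
Proof.
move=> hf; rewrite -pevalZ -(euler_homog hf) !peval_sum; apply: eq_bigr => i _.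
by rewrite pevalZ pevalM pevalX.
Qed.

End PolynomialCalculus.

(** * Integrals of polynomials over the sphere, orthogonality and zonal expansions *)

Section SphereFunctional.
Variables (R : realType) (n : nat).
Local Notation P := {mpoly R[n]}.
Implicit Types (f g h : P) (p q : 'I_n) (x z : 'rV[R]_n).

Lemma sphere_fun_peval_comp (X : 'rV[R]_n -> 'rV[R]_n) f :
  (forall i, sphere_fun (fun x => X x 0 i)) -> sphere_fun (fun x => peval f (X x)).
Proof.
move=> sX; elim/mpoly_alg_ind: f => [c|i|f g sf sg|f g sf sg].
- by rewrite (_ : (fun x => _) = fun=> c);
    [exact: sphere_fun_cst|apply/funext => x; exact: pevalC].
- by rewrite (_ : (fun x => _) = fun x => X x 0 i);
    [exact: sX|apply/funext => x; exact: pevalX].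
- by rewrite (_ : (fun x => _) = fun x => peval f (X x) + peval g (X x));
    [exact: sphere_funD|apply/funext => x; exact: pevalD].
- by rewrite (_ : (fun x => _) = fun x => peval f (X x) * peval g (X x));
    [exact: sphere_funM|apply/funext => x; exact: pevalM].
Qed.

Lemma sphere_fun_peval f : sphere_fun (peval f).
Proof. by apply: (@sphere_fun_peval_comp id) => i; exact: sphere_fun_coord. Qed.

Lemma sphere_fun_rotv p q c s i : sphere_fun (fun x : 'rV[R]_n => rotv p q c s x 0 i).
Proof.
have [ip|ip] := eqVneq i p.
  rewrite (_ : (fun x => _) = fun x => c * x 0 p + (- s) * x 0 q).
    by apply: sphere_funD; apply: sphere_funZ; exact: sphere_fun_coord.
  by apply/funext => x; rewrite mxE ip eqxx mulNr.
have [iq|iq] := eqVneq i q.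
  rewrite (_ : (fun x => _) = fun x => s * x 0 p + c * x 0 q).
    by apply: sphere_funD; apply: sphere_funZ; exact: sphere_fun_coord.
  by apply/funext => x; rewrite mxE (negPf ip) iq eqxx.
rewrite (_ : (fun x => _) = fun x => x 0 i); first exact: sphere_fun_coord.
by apply/funext => x; rewrite mxE (negPf ip) (negPf iq).
Qed.

(** A first-order expansion with remainder uniform on the sphere, by algebraic induction on [f]. The
    condition [0 <= c] selects the rotations near the identity: it gives [1 - c <= s ^+ 2]. *)
Lemma rotv_expansion p q f : p != q -> exists C : R, forall c s x, 0 <= c ->
  c ^+ 2 + s ^+ 2 = 1 -> on_sphere x ->
  `|peval f (rotv p q c s x) - peval f x - s * peval (drot p q f) x| <= C * s ^+ 2.
Proof.
move=> pq.
have c1 (c s : R) : 0 <= c -> c ^+ 2 + s ^+ 2 = 1 -> `|c - 1| <= s ^+ 2.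
  move=> c0 cs; have cle1 : c <= 1 by have := sqr_ge0 s; nra.
  by rewrite ler0_norm ?subr_le0//; nra.
elim/mpoly_alg_ind: f => [a|i|f g [C HC] [D HD]|f g [C HC] [D HD]].
- by exists 0 => c s x _ _ _; rewrite drotC peval0 !pevalC mulr0 subr0 subrr normr0 mul0r.
- exists 1 => c s x c0 cs sx; rewrite mul1r /drot !mderivXU pevalB !pevalM !pevalX mxE.
  have [ip|ip] := eqVneq i p.
    rewrite ip (negPf pq) peval0 -[1]/(1%:MP : P) pevalC.
    rewrite (_ : _ - _ = (c - 1) * x 0 p); last by ring.
    rewrite normrM -[leRHS]mulr1; apply: ler_pM => //; first exact: c1.
    exact: on_sphere_coord.
  have [iq|iq] := eqVneq i q.
    rewrite iq peval0 -[1]/(1%:MP : P) pevalC.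
    rewrite (_ : _ - _ = (c - 1) * x 0 q); last by ring.
    rewrite normrM -[leRHS]mulr1; apply: ler_pM => //; first exact: c1.
    exact: on_sphere_coord.
  by rewrite peval0 !mulr0 !subrr mulr0 subrr normr0 sqr_ge0.
- exists (C + D) => c s x c0 cs sx.
  rewrite drotD (pevalD f g) (pevalD f g) (pevalD (drot p q f)).
  have := HC c s x c0 cs sx; have := HD c s x c0 cs sx.
  move: (peval f (rotv _ _ _ _ _)) (peval g (rotv _ _ _ _ _)) => F G h2 h1.
  rewrite mulrDl (_ : _ - _ - _ = F - peval f x - s * peval (drot p q f) x +
    (G - peval g x - s * peval (drot p q g) x)); last by ring.
  by apply: le_trans (ler_normD _ _) _; exact: lerD.
have [_ [Bf bf]] := sphere_fun_peval f; have [_ [Bg bg]] := sphere_fun_peval g.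
have [_ [Df df]] := sphere_fun_peval (drot p q f).
have [_ [Dg dg]] := sphere_fun_peval (drot p q g).
(* The three terms bound the remainder of [f] times rotated [g], the first-order part of [f] times
   the remainder of [g], and the product of the two first-order terms. *)
exists (C * Bg + (Bf + Df) * D + Df * Dg) => c s x c0 cs sx.
rewrite drotM pevalD !pevalM.
have srx : on_sphere (rotv p q c s x) by rewrite /on_sphere dotp_rotv.
have s1 : `|s| <= 1.
  by rewrite -(@ler_pXn2r _ 2) ?nnegrE// expr1n real_normK ?num_real//; nra.
have := HC c s x c0 cs sx; have := HD c s x c0 cs sx.
have := bg _ srx; have := bf _ sx; have := df _ sx; have := dg _ sx.
move: (peval f (rotv _ _ _ _ _)) (peval g (rotv _ _ _ _ _)) => F G.
move: (peval f x) (peval g x) (peval (drot p q f) x) (peval (drot p q g) x) => f0 g0 f1 g1.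
move=> b4 b3 b2 b1 h2 h1.
rewrite (_ : _ - _ - _ = (F - f0 - s * f1) * G + (f0 + s * f1) * (G - g0 - s * g1)
  + (f1 * g1) * s ^+ 2); last by ring.
rewrite [leRHS](_ : _ = C * s ^+ 2 * Bg + (Bf + Df) * (D * s ^+ 2) + Df * Dg * s ^+ 2);
  last by ring.
apply: le_trans (ler_normD _ _) _; apply: lerD; last first.
  rewrite normrM normrM [`|s ^+ 2|]ger0_norm ?sqr_ge0//.
  by apply: ler_wpM2r; [exact: sqr_ge0|exact: ler_pM].
apply: le_trans (ler_normD _ _) _; apply: lerD.
  by rewrite normrM ler_pM.
rewrite normrM; apply: ler_pM => //.
apply: le_trans (ler_normD _ _) _; apply: lerD => //.
by rewrite normrM -[leRHS]mul1r ler_pM.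
Qed.

Lemma sint_pevalD f g : sint (peval (f + g)) = sint (peval f) + sint (peval g).
Proof.
rewrite -sintD; try exact: sphere_fun_peval.
by apply: eq_sint => x _; exact: pevalD.
Qed.

Lemma sint_pevalZ a f : sint (peval (a *: f)) = a * sint (peval f).
Proof.
rewrite -sintZ; last exact: sphere_fun_peval.
by apply: eq_sint => x _; exact: pevalZ.
Qed.

Lemma sint_peval0 : sint (peval (0 : P)) = 0.
Proof. by rewrite -(scale0r (0 : P)) sint_pevalZ mul0r. Qed.

Lemma sint_pevalB f g : sint (peval (f - g)) = sint (peval f) - sint (peval g).
Proof. by rewrite -[- g]scaleN1r sint_pevalD sint_pevalZ mulN1r. Qed.

Lemma sint_peval_sum (I : Type) (r : seq I) (F : I -> P) :
  sint (peval (\sum_(i <- r) F i)) = \sum_(i <- r) sint (peval (F i)).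
Proof.
elim: r => [|i r IH]; first by rewrite !big_nil sint_peval0.
by rewrite !big_cons sint_pevalD IH.
Qed.

(** By invariance the zeroth-order terms cancel, so [s] times the integral is [O(s ^ 2)]; dividing
    by [s] and shrinking [s] gives 0. *)
Lemma sint_drot_adjacent p q f : q = p.+1 :> nat -> sint (peval (drot p q f)) = 0.
Proof.
move=> qp; have pq : p != q by rewrite -val_eqE /= qp neq_ltn ltnSn.
have [C HC] := rotv_expansion f pq.
set w := sint (fun _ : 'rV[R]_n => 1).
have w0 : 0 <= w by apply: sint_ge0.
apply/eqP; rewrite -normr_le0; apply/ler_addgt0Pr => e e0; rewrite add0r.
have K0 : 0 < `|C| * w + 1 by rewrite ltr_wpDl// mulr_ge0.
(* The bound by 1 lets [s] be a sine; the [+ 1] keeps the denominator positive. *)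
pose s := Num.min 1 (e / (`|C| * w + 1)).
have s0 : 0 < s by rewrite lt_min ltr01 divr_gt0.
have s1 : s <= 1 by rewrite ge_min lexx.
have se : s * (`|C| * w + 1) <= e by rewrite -ler_pdivlMr// ge_min lexx orbT.
pose c := Num.sqrt (1 - s ^+ 2).
have cs : c ^+ 2 + s ^+ 2 = 1.
  by rewrite sqr_sqrtr ?subrK// subr_ge0 expr_le1//; exact: ltW.
have snz : s != 0 by rewrite gt_eqF.
have sfr : sphere_fun (fun x => peval f (rotv p q c s x)).
  by apply: sphere_fun_peval_comp => i; exact: sphere_fun_rotv.
have e1 : sint (fun x => peval f (rotv p q c s x) + (-1) * peval f x +
    (- s) * peval (drot p q f) x) = - s * sint (peval (drot p q f)).
  rewrite !sintD ?sintZ ?(sint_rotv qp snz cs) ?mulN1r ?subrr ?add0r//;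
    try exact: sphere_fun_peval.
  - by apply: sphere_funZ; exact: sphere_fun_peval.
  - by apply: sphere_funD => //; apply: sphere_funZ; exact: sphere_fun_peval.
  - by apply: sphere_funZ; exact: sphere_fun_peval.
have : `|sint (fun x => peval f (rotv p q c s x) + (-1) * peval f x +
    (- s) * peval (drot p q f) x)| <= (C * s ^+ 2) * w.
  apply: sint_norm_le.
    apply: sphere_funD; first apply: sphere_funD => //;
      by apply: sphere_funZ; exact: sphere_fun_peval.
  by move=> x sx; rewrite mulN1r mulNr; apply: HC => //; exact: sqrtr_ge0.
rewrite e1 normrM normrN (gtr0_norm s0) => h.
rewrite -(ler_pM2l s0) (le_trans h)//.
rewrite (_ : C * s ^+ 2 * w = s * (s * (C * w))); last by ring.
rewrite ler_pM2l//; apply: le_trans se; rewrite ler_pM2l//.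
by rewrite ler_wpDr// ler_wpM2r// ler_norm.
Qed.

(** With [r] just below [q], both terms of the commutator begin with a rotation of smaller gap,
    whose integral vanishes whatever it is applied to. *)
Lemma sint_drot_lt k p q f : q = (p + k).+1 :> nat -> sint (peval (drot p q f)) = 0.
Proof.
elim: k p q f => [|k IH] p q f; first by rewrite addn0; exact: sint_drot_adjacent.
move=> qpk; have rn : ((p + k).+1 < n)%N by rewrite (ltn_trans _ (ltn_ord q))// qpk addnS.
pose r := Ordinal rn.
have neq (a b : 'I_n) : (a < b)%N -> a != b by move=> ab; rewrite -val_eqE neq_ltn ab.
rewrite (@drot_comm _ _ p r q f); last 3 first.
- by apply: neq; rewrite /= ltnS leq_addr.
- by apply: neq; rewrite /= qpk addnS.
- by apply: neq; rewrite qpk ltnS leq_addr.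
by rewrite sint_pevalB (IH p r)// sint_drot_adjacent ?subrr//= qpk addnS.
Qed.

Lemma sint_drot p q f : sint (peval (drot p q f)) = 0.
Proof.
have h (a b : 'I_n) : (a < b)%N -> sint (peval (drot a b f)) = 0.
  move=> ab; apply: (@sint_drot_lt (b - a.+1)).
  by rewrite -addSn subnKC.
have [/h//|/h e|/val_inj ->] := ltngtP p q.
  by rewrite drotN -scaleN1r sint_pevalZ e mulr0.
by rewrite /drot subrr sint_peval0.
Qed.

Lemma sint_sqnormM f : sint (peval (sqnorm R n * f)) = sint (peval f).
Proof. by apply: eq_sint => x sx; rewrite pevalM peval_sqnorm sx mul1r. Qed.

Lemma sint_laplacian f m : f \is m.-homog ->
  sint (peval (laplacian f)) = m%:R * (m%:R + n%:R - 2) * sint (peval f).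
Proof.
move=> hf; have := congr1 (fun g => sint (peval g)) (casimir hf).
rewrite /= sint_peval_sum big1; last first.
  by move=> i _; rewrite sint_peval_sum big1// => j _; exact: sint_drot.
rewrite sint_pevalZ sint_pevalB sint_sqnormM sint_pevalZ => /esym/eqP.
by rewrite mulf_eq0 pnatr_eq0 /= subr_eq0 => /eqP.
Qed.

Lemma sint_drot_by_parts p q f g :
  sint (peval (drot p q f * g)) = - sint (peval (f * drot p q g)).
Proof.
by apply/eqP; rewrite -addr_eq0 -sint_pevalD -drotM sint_drot.
Qed.

Hypothesis n2 : (2 <= n)%N.

(** The sum of squares of infinitesimal rotations is symmetric for the sphere integral, and its
    eigenvalues on the two degrees differ by a multiple of [(l - k) * (l + k + n - 2)], nonzero for
    [n >= 2]. *)
Lemma harmonic_orthogonal k l f g : harm_homog k f -> harm_homog l g -> k != l ->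
  sint (peval (f * g)) = 0.
Proof.
move=> /harm_homogE[hf lf] /harm_homogE[hg lg] kl.
have e1 : sint (peval ((\sum_(p < n) \sum_(q < n) drot p q (drot p q f)) * g)) =
   sint (peval (f * (\sum_(p < n) \sum_(q < n) drot p q (drot p q g)))).
  rewrite mulr_suml mulr_sumr !sint_peval_sum; apply: eq_bigr => p _.
  rewrite mulr_suml mulr_sumr !sint_peval_sum; apply: eq_bigr => q _.
  by rewrite !sint_drot_by_parts -[RHS]opprK -sint_drot_by_parts.
have e2 (a : R) (u v : P) : sint (peval ((2%:R *: (0 - a *: u)) * v)) = (- 2 * a) * sint (peval (u * v)).
  rewrite -sint_pevalZ sub0r -scaleNr scalerA -scalerAl; congr (sint (peval (_ *: _))).
  by ring.
move: e1; rewrite (casimir hf) (casimir hg) lf lg mulr0 e2 [f * (_ *: _)]mulrC e2 [g * f]mulrC.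
move=> /eqP; rewrite -subr_eq0 -mulrBl mulf_eq0 => /orP[|/eqP//].
rewrite (_ : _ - _ = (2 * (l%:R - k%:R)) * (l%:R + k%:R + n%:R - 2)); last by ring.
rewrite !mulf_eq0 pnatr_eq0 subr_eq0 eqr_nat (eq_sym l k) (negPf kl) /= => /eqP h.
have : (0:R) < (l + k)%:R.
  by rewrite ltr0n addn_gt0; case: (l) (k) kl => [|?] [|?].
have : 2 <= n%:R :> R by rewrite ler_nat.
by rewrite natrD; lra.
Qed.

(** The Funk-Hecke formula for the kernel [(x . z) ^ m]. Strong induction on [m]: the Laplacian
    lowers the power, and [moment_laplacian] is the matching recurrence. *)
Lemma sint_linformX_harm m k f x : on_sphere x -> harm_homog k f ->
  sint (peval (linform x ^+ m * f)) =
  moment (sint (fun _ : 'rV[R]_n => 1)) n m k * peval f x.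
Proof.
have n0 : (0 < n)%N by exact: ltn_trans n2.
move=> sx; have [b] := ubnP m; elim: b m k f => // b IH m k f mb Hf.
have /harm_homogE[hf lf] := Hf.
have [/eqP|mk0] := eqVneq (m + k)%N 0%N.
  rewrite addn_eq0 => /andP[/eqP m0 /eqP k0]; rewrite m0 k0 in hf *.
  rewrite expr0 mul1r (dhomog0_C hf) pevalC /= mulrC -sintZ; last exact: sphere_fun_cst.
  by apply: eq_sint => z _; rewrite pevalC mulr1.
have hq : linform x ^+ m * f \is (m + k).-homog.
  apply: dhomogM => //; rewrite -[m in X in _ \is X]mul1n.
  by apply: dhomogMn; exact: linform_homog.
(* The factor can be cancelled once the total degree is positive; degree 0 was the total mass,
   treated above. *)
have a0 : (m + k)%:R * ((m + k)%:R + n%:R - 2) != 0 :> R.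
  rewrite mulf_neq0 ?pnatr_eq0// gt_eqF//.
  have : (1:R) <= (m + k)%:R by rewrite ler1n lt0n.
  by have : (2:R) <= n%:R by [rewrite ler_nat]; lra.
apply: (mulfI a0); rewrite [RHS]mulrA moment_laplacian// -(sint_laplacian hq).
rewrite laplacian_linformX// lf mulr0 addr0 sint_pevalD !sint_pevalZ [RHS]mulrDl.
congr (_ + _).
  case: m mb {hq a0 mk0} => [|[|m]] mb; rewrite ?mul0r ?subrr ?mulr0 ?mul0r//.
  by rewrite (IH _ k)// ?mulrA// (ltn_trans (ltnSn _)).
case: m mb {hq a0 mk0} => [|m] mb; first by rewrite mulr0 !mul0r.
by rewrite (IH m k.-1 _ _ (dirderiv_harm x Hf))// (peval_dirderiv x hf) /=; ring.
Qed.

Lemma zonal_expansion (N : nat -> nat) (Y : forall k, 'I_(N k) -> P) m x z :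
  (forall k, sh_onb k (Y k)) -> on_sphere x -> on_sphere z ->
  dotp x z ^+ m = \sum_(k < m.+1) moment (sint (fun _ : 'rV[R]_n => 1)) n m k *
     \sum_(j < N k) peval (Y k j) x * peval (Y k j) z.
Proof.
move=> HY sx sz.
have n0 : (0 < n)%N by exact: ltn_trans n2.
have hq : linform x ^+ m \is m.-homog.
  by rewrite -[m in X in _ \is X]mul1n; apply: dhomogMn; exact: linform_homog.
have [h [hh eh]] := harmonic_decomposition n0 hq.
rewrite -peval_linform -pevalXn eh//; apply: eq_bigr => k _.
have [Yh [Yo Ys]] := HY k.
have [a ea] := Ys _ (hh k).
rewrite ea// mulr_sumr; apply: eq_bigr => j _.
rewrite mulrA; congr (_ * _).
rewrite -sint_linformX_harm//.
transitivity (sint (peval (h k * Y k j))).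
  transitivity (sint (peval (\sum_(i < N k) a i *: (Y k i * Y k j)))).
    rewrite sint_peval_sum (bigD1 j)//= big1 ?addr0.
      rewrite sint_pevalZ (_ : sint _ = 1) ?mulr1//.
      by rewrite -[RHS]/(true%:R) -[true](eqxx j) -Yo; apply: eq_sint => y _; exact: pevalM.
    move=> i ij; rewrite sint_pevalZ (_ : sint _ = 0) ?mulr0//.
    by rewrite -[RHS]/(false%:R) -(negPf ij) -Yo; apply: eq_sint => y _; exact: pevalM.
  apply: eq_sint => y sy; rewrite pevalM (ea y sy) peval_sum mulr_suml.
  by apply: eq_bigr => i _; rewrite pevalZ pevalM mulrA.
(* The components of other degrees are orthogonal to [Y k j], so the whole decomposition may replace
   [h k]; on the sphere it equals [linform x ^+ m]. *)
transitivity (sint (peval (\sum_(l < m.+1) h l * Y k j))).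
  rewrite sint_peval_sum (bigD1 k)//= big1 ?addr0// => l lk.
  exact: (harmonic_orthogonal (hh l) (Yh j)).
apply: eq_sint => y sy; rewrite pevalM (eh y sy) peval_sum mulr_suml.
by apply: eq_bigr => l _; exact: pevalM.
Qed.

End SphereFunctional.

(** * Termwise differentiation of power series on the unit interval *)

Section PowerSeries.
Variable R : realType.
Implicit Types (f : nat -> R) (t r q : R).

(** [q ^+ n] is the smallest of the first [n.+1] terms of the geometric series. *)
Lemma natS_exp_le q n : 0 <= q -> q < 1 -> n.+1%:R * q ^+ n <= (1 - q)^-1.
Proof.
move=> q0 q1; have q1' : 0 < 1 - q by rewrite subr_gt0.
rewrite -[leRHS]mul1r ler_pdivlMr//.
apply: (@le_trans _ _ ((\sum_(i < n.+1) q ^+ i) * (1 - q))).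
  rewrite ler_wpM2r ?(ltW q1')//.
  rewrite -[X in X%:R]card_ord mulr_natl -sumr_const; apply: ler_sum => i _.
  by apply: ler_wiXn2l => //; [exact: ltW|rewrite -ltnS].
rewrite mulrC -[1 - q]opprB mulNr -subrX1 opprB lerBlDr lerDl.
exact: exprn_ge0.
Qed.

Lemma is_cvg_pseries_diffs f : (forall r, `|r| < 1 -> cvgn (pseries f r)) ->
  forall r, `|r| < 1 -> cvgn (pseries (pseries_diffs f) r).
Proof.
(* Two intermediate radii: convergence at [y'] gives absolute convergence at [y], and the ratio of
   [|r|] to [y] absorbs the factor [n.+1] of the derived series. *)
move=> cf r r1; pose y := (`|r| + 1) / 2; pose y' := (y + 1) / 2.
have r0 := normr_ge0 r.
have y0 : 0 < y by rewrite /y; lra.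
have ry : `|r| < y by rewrite /y; lra.
have y1 : y < 1 by rewrite /y; lra.
have yy' : y < y' by rewrite /y'; lra.
have y'1 : y' < 1 by rewrite /y'; lra.
have cy : cvgn (pseries (fun i => `|f i|) y).
  apply: (@is_cvg_pseries_inside_norm _ f y'); last by rewrite !gtr0_norm// (lt_trans y0).
  by apply: cf; rewrite gtr0_norm// (lt_trans y0).
pose q := `|r| / y.
have q0 : 0 <= q by rewrite divr_ge0// ltW.
have q1 : q < 1 by rewrite ltr_pdivrMr// mul1r.
have qi : 0 <= (1 - q)^-1 by rewrite invr_ge0 subr_ge0 ltW.
pose v n := ((1 - q)^-1 / y) *: (`|f n.+1| * y ^+ n.+1).
apply: normed_cvg; apply: (@series_le_cvg _ _ v) => [n|n|n|].
- exact: normr_ge0.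
- by rewrite /v mulr_ge0 ?divr_ge0 ?mulr_ge0 ?exprn_ge0// ltW.
- rewrite /= /pseries_diffs /v !normrM normr_nat normrX.
  have -> : `|r| ^+ n = q ^+ n * y ^+ n by rewrite -exprMn divfK// gt_eqF.
  rewrite [leLHS](_ : _ = (n.+1%:R * q ^+ n) * (`|f n.+1| * y ^+ n)); last by ring.
  rewrite [leRHS](_ : _ = (1 - q)^-1 * (`|f n.+1| * y ^+ n)).
    by rewrite ler_wpM2r ?natS_exp_le// mulr_ge0// exprn_ge0// ltW.
  rewrite /GRing.scale /= -mulrA; congr (_ * _); rewrite mulrCA; congr (_ * _).
  by rewrite exprS mulrA mulVf ?mul1r// gt_eqF.
- apply: is_cvg_seriesZ.
  rewrite (_ : series _ = (fun n => pseries (fun i => `|f i|) y n.+1 - `|f 0|)).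
    apply: is_cvgB; last exact: is_cvg_cst.
    have /cvg_ex[l hl] := cy; apply/cvg_ex; exists l.
    by have := cvg_shiftS (pseries (fun i => `|f i|) y) (nbhs l) => ->.
  apply/funext => n; rewrite /pseries /series /= big_nat_recl// expr0 mulr1.
  by rewrite addrC addKr.
Qed.

Lemma is_derive_pseries f t : (forall r, `|r| < 1 -> cvgn (pseries f r)) -> `|t| < 1 ->
  is_derive t 1 (fun x => limn (pseries f x)) (limn (pseries (pseries_diffs f) t)).
Proof.
move=> cf t1; have cf1 := is_cvg_pseries_diffs cf; have cf2 := is_cvg_pseries_diffs cf1.
pose K := (`|t| + 1) / 2; have t0 := normr_ge0 t.
have K0 : 0 < K by rewrite /K; lra.
have K1 : `|K| < 1 by rewrite gtr0_norm// /K; lra.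
apply: (@pseries_snd_diffs _ _ K); [exact: cf|exact: cf1|exact: cf2|].
by rewrite (gtr0_norm K0) /K; lra.
Qed.

Lemma is_derive0_unit_interval (g : R -> R) :
  (forall t, `|t| < 1 -> is_derive t 1 g 0) -> forall t, `|t| < 1 -> g t = g 0.
Proof.
move=> dg t; rewrite ltr_norml => /andP[t1 t2].
have H (a b : R) : -1 < a -> b < 1 -> a <= b -> g b = g a.
  move=> a1 b1 ab.
  have d x : x \in `[a, b] -> is_derive x (1 : R) g 0.
    by rewrite in_itv /= => /andP[ax xb]; apply: dg; rewrite ltr_norml; apply/andP; split; lra.
  have h1 x : x \in `]a, b[%R -> is_derive x (1 : R) g (cst (0 : R) x).
    by rewrite in_itv /= => /andP[ax xb]; apply: d; rewrite in_itv /= !ltW.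
  have h2 : {within `[a, b], continuous g}.
    by apply: derivable_within_continuous => x /d [].
  have [e _ he] := MVT_segment ab h1 h2.
  by apply/eqP; rewrite -subr_eq0 he /= mul0r.
have [t0|t0] := leP 0 t; first by apply: H => //; lra.
by apply/esym; apply: H => //; exact: ltW.
Qed.

End PowerSeries.

(** * The power series of the Laplace profile on [-1, 1] *)

Section LaplaceKernel.
Variables (R : realType) (c : R).
Hypothesis c0 : 0 < c.

Definition lap_profile t : R := expR (- (c * Num.sqrt (1 - t))).

Local Notation a := (lap_coef c).
Local Notation F := (fun t => limn (pseries a t)).
Local Notation F1 := (fun t => limn (pseries (pseries_diffs a) t)).
Local Notation F2 := (fun t => limn (pseries (pseries_diffs (pseries_diffs a)) t)).

Definition lap_sum := limn (fun N => \sum_(n < N) a n).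

Lemma lap_sum_cvg : (fun N => \sum_(n < N) a n) @ \oo --> lap_sum.
Proof.
have [A HA] := sum_lap_coef_bounded c0.
apply: nondecreasing_is_cvgn.
  by apply/nondecreasing_seqP => n; rewrite big_ord_recr /= lerDl ltW// lap_coef_gt0.
by exists A => _ [N _ <-].
Qed.

Lemma lap_sum_le N : \sum_(n < N) a n <= lap_sum.
Proof.
apply: (@nondecreasing_cvgn_le _ (fun N => \sum_(n < N) a n)).
  by apply/nondecreasing_seqP => n; rewrite big_ord_recr /= lerDl ltW// lap_coef_gt0.
by apply: cvgP; exact: lap_sum_cvg.
Qed.

Lemma is_cvg_lap_pseries r : `|r| < 1 -> cvgn (pseries a r).
Proof.
move=> r1; apply: (@is_cvg_pseries_inside _ _ 1); last by rewrite normr1.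
rewrite /pseries /series /=.
rewrite (_ : (fun n => _) = (fun N => \sum_(n < N) a n)).
  by apply: cvgP; exact: lap_sum_cvg.
apply/funext => N; rewrite big_mkord; apply: eq_bigr => i _.
by rewrite expr1n mulr1.
Qed.

Lemma lap_ode t : `|t| < 1 -> (1 - t) * F2 t = F1 t / 2 + c ^+ 2 / 4 * F t.
Proof.
move=> t1.
have cv0 := is_cvg_lap_pseries; have cv1 := is_cvg_pseries_diffs cv0.
have cv2 := is_cvg_pseries_diffs cv1.
have S f : cvgn (pseries f t) -> (fun N => pseries f t N.+1) @ \oo --> limn (pseries f t).
  by move=> cf; have := cvg_shiftS (pseries f t) (nbhs (limn (pseries f t))) => ->.
set d1 := pseries_diffs a; set d2 := pseries_diffs d1.
(* The equation for partial sums. Multiplication by [t] shifts the index, hence the sum to [N] on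
   the right against sums to [N.+1] elsewhere. *)
have rec N : pseries d2 t N.+1 =
    t * pseries d2 t N + pseries d1 t N.+1 / 2 + c ^+ 2 / 4 * pseries a t N.+1.
  have d2E n : d2 n = n%:R * d1 n + d1 n / 2 + c ^+ 2 / 4 * a n.
    rewrite /d2 /d1 /pseries_diffs lap_coefSS.
    have n0 := ler0n R n; rewrite -[n.+2%:R]natr1 -[n.+1%:R]natr1.
    by move: (n%:R) n0 => x x0; field; rewrite !gt_eqF//; lra.
  have -> : t * pseries d2 t N = \sum_(0 <= n < N.+1) n%:R * d1 n * t ^+ n.
    rewrite big_nat_recl// mul0r mul0r add0r /pseries /series /= mulr_sumr.
    by apply: eq_bigr => n _; rewrite /d2 {1}/pseries_diffs exprS; ring.
  rewrite /pseries /series /= mulr_suml mulr_sumr -!big_split /=.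
  by apply: eq_bigr => n _; rewrite d2E; ring.
have l1 : (fun N => pseries d2 t N.+1) @ \oo --> F2 t by apply: S; exact: cv2.
have l2 : (fun N => t * pseries d2 t N + pseries d1 t N.+1 / 2 +
    c ^+ 2 / 4 * pseries a t N.+1) @ \oo --> t * F2 t + F1 t / 2 + c ^+ 2 / 4 * F t.
  apply: cvgD; first apply: cvgD.
  - by apply: cvgMr; exact: cv2.
  - by apply: cvgMl; apply: S; exact: cv1.
  - by apply: cvgMr; apply: S; exact: cv0.
rewrite (_ : (fun N => _) = (fun N => t * pseries d2 t N + pseries d1 t N.+1 / 2 +
    c ^+ 2 / 4 * pseries a t N.+1)) in l1; last by apply/funext.
have e := cvg_unique (@Rhausdorff R) l1 l2.
by rewrite mulrBl mul1r {1}e; ring.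
Qed.

Lemma is_derive_sqrt1B (t : R) : t < 1 ->
  is_derive t 1 (fun t : R => Num.sqrt (1 - t)) (- (2 * Num.sqrt (1 - t))^-1).
Proof.
move=> t1; have h : 0 < 1 - t by rewrite subr_gt0.
have d1 : is_derive t 1 (fun t : R => 1 - t) (-1).
  have h1 : is_derive t (1 : R) (cst (1 : R) - @id R) (0 - 1) by exact: is_deriveB.
  by apply: (is_derive_eq h1); rewrite sub0r.
have := @is_derive1_comp _ Num.sqrt (fun t => 1 - t) t _ _ (is_derive1_sqrt h) d1.
by move=> /is_derive_eq; apply; rewrite mulrN1.
Qed.

Lemma is_derive_exp_sqrt (b t : R) : t < 1 ->
  is_derive t 1 (fun t : R => expR (b * Num.sqrt (1 - t)))
    (- (b / (2 * Num.sqrt (1 - t))) * expR (b * Num.sqrt (1 - t))).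
Proof.
move=> t1; have d1 := is_derive_sqrt1B t1.
have d2 : is_derive t 1 (fun t : R => b * Num.sqrt (1 - t)) (b * - (2 * Num.sqrt (1 - t))^-1).
  exact: (@is_deriveZ _ _ _ _ b _ _ _ d1).
have := @is_derive1_comp _ expR _ t _ _ (is_derive_expR _) d2.
by move=> /is_derive_eq; apply; ring.
Qed.

(* In the variable [w = sqrt (1 - t)] the differential equation reads
   [F_ww = c ^ 2 F]; [Q] is [(c F + F_w) * expR (- c * w)], hence constant. *)
Lemma lap_profile_series t : `|t| < 1 -> F t = lap_profile t.
Proof.
have cv0 := is_cvg_lap_pseries; have cv1 := is_cvg_pseries_diffs cv0.
have lt1 (s : R) : `|s| < 1 -> s < 1 by apply: le_lt_trans; exact: ler_norm.
have dF (s : R) : `|s| < 1 -> is_derive s 1 F (F1 s) by exact: is_derive_pseries.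
have dF1 (s : R) : `|s| < 1 -> is_derive s 1 F1 (F2 s) by exact: is_derive_pseries.
have w0 (s : R) : s < 1 -> 0 < Num.sqrt (1 - s) by move=> ?; rewrite sqrtr_gt0 subr_gt0.
have at0 f : limn (pseries f (0 : R)) = f 0.
  apply/cvg_lim => //; apply: cvg_near_cst; near=> N.
  have N0 : (0 < N)%N by near: N; exact: nbhs_infty_gt.
  rewrite /pseries /series /= -(prednK N0) big_nat_recl// expr0 mulr1 big1 ?addr0// => i _.
  by rewrite expr0n mulr0.
pose Q s := (c * F s - 2 * (Num.sqrt (1 - s) * F1 s)) * expR (- c * Num.sqrt (1 - s)).
(* At 0 the value is [(c * a 0 - 2 * a 1) * expR (- c)], zero by the choice of the first two
   coefficients; this excludes the growing solution [expR (c * w)]. *)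
have Q0 s : `|s| < 1 -> Q s = 0.
  move=> s1; rewrite (@is_derive0_unit_interval _ Q _ s s1).
    by rewrite /Q !at0 /pseries_diffs lap_coef0 lap_coef1 subr0 sqrtr1; field.
  move=> u u1; have u1' := lt1 u u1; have wu := w0 u u1'.
  have dw := is_derive_sqrt1B u1'; have de := is_derive_exp_sqrt (- c) u1'.
  have d1 := @is_deriveZ _ _ _ _ c _ _ _ (dF u u1).
  have d2 := @is_deriveM _ _ _ _ _ _ _ _ dw (dF1 u u1).
  have d3 := @is_deriveZ _ _ _ _ (2 : R) _ _ _ d2.
  have d4 := @is_deriveM _ _ _ _ _ _ _ _ (@is_deriveB _ _ _ _ _ _ _ _ _ d1 d3) de.
  apply: (is_derive_eq d4).
  have ode := lap_ode u1.
  have wsq : Num.sqrt (1 - u) ^+ 2 = 1 - u by rewrite sqr_sqrtr// subr_ge0 ltW.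
  rewrite -wsq in ode.
  change ((c * F u - 2 * (Num.sqrt (1 - u) * F1 u)) *
      (- (- c / (2 * Num.sqrt (1 - u))) * expR (- c * Num.sqrt (1 - u))) +
    expR (- c * Num.sqrt (1 - u)) * (c * F1 u - 2 *
      (Num.sqrt (1 - u) * F2 u + F1 u * - (2 * Num.sqrt (1 - u))^-1)) = 0).
  move: (Num.sqrt (1 - u)) wu ode => w wu ode.
  move: (F u) (F1 u) (F2 u) ode => x x1 x2 ode.
  have wnz : w != 0 by rewrite gt_eqF.
  have ode' : w * x2 = (x1 / 2 + c ^+ 2 / 4 * x) / w.
    by apply: (mulIf wnz); rewrite divfK// -ode expr2; ring.
  by rewrite ode'; field.
(* The vanishing of [Q] is a first-order equation for [F], and it makes [H] constant. *)
pose H s := F s * expR (c * Num.sqrt (1 - s)).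
have H1 s : `|s| < 1 -> H s = 1.
  move=> s1; rewrite (@is_derive0_unit_interval _ H _ s s1).
    by rewrite /H at0 lap_coef0 subr0 sqrtr1 mulr1 -expRD addNr expR0.
  move=> u u1; have u1' := lt1 u u1; have wu := w0 u u1'.
  have de := is_derive_exp_sqrt c u1'.
  have d4 := @is_deriveM _ _ _ _ _ _ _ _ (dF u u1) de.
  apply: (is_derive_eq d4).
  have /eqP := Q0 u u1; rewrite /Q mulf_eq0 (gt_eqF (expR_gt0 _)) orbF subr_eq0 => /eqP e.
  rewrite /GRing.scale /=.
  move: (Num.sqrt (1 - u)) wu e => w wu e.
  move: (F u) (F1 u) e => x x1 e.
  have wnz : w != 0 by rewrite gt_eqF.
  have -> : x1 = c * x / (2 * w) by rewrite e; field.
  by field.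
move=> t1; have := H1 t t1; rewrite /H /lap_profile => e.
by rewrite expRN -[LHS]mulr1 -[X in _ * X](divff (lt0r_neq0 (expR_gt0 (c * Num.sqrt (1 - t))))) mulrA e mul1r.
Unshelve. all: end_near. Qed.

(** Stated for any [u] bounded by 1, since it serves both for powers of [t] and for truncated zonal
    expansions. *)
Lemma lap_partial_sum_le (u : nat -> R) M N : (M <= N)%N -> (forall n, `|u n| <= 1) ->
  `|\sum_(n < N) a n * u n - \sum_(n < M) a n * u n| <= lap_sum - \sum_(n < M) a n.
Proof.
move=> MN u1; have E (f : nat -> R) : \sum_(n < N) f n = \sum_(n < M) f n + \sum_(M <= n < N) f n :> R.
  by rewrite -!(big_mkord xpredT f) (@big_cat_nat _ _ _ M).
apply: (@le_trans _ _ (\sum_(n < N) a n - \sum_(n < M) a n)); last first.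
  by rewrite lerD2r lap_sum_le.
rewrite (E (fun n => a n * u n)) (E a) [X in `|X|]addrC addKr [leRHS]addrC addKr.
apply: le_trans (ler_norm_sum _ _ _) _; apply: ler_sum => n _.
by rewrite normrM ger0_norm ?ler_piMr// ltW// lap_coef_gt0.
Qed.

Lemma continuous_lap_profile : continuous lap_profile.
Proof.
move=> t.
have h1 : {for t, continuous (fun t : R => 1 - t)}.
  by apply: cvgB; [exact: cvg_cst|exact: cvg_id].
have h2 := continuous_comp h1 (@sqrt_continuous R _).
have h3 : {for t, continuous (fun t : R => - (c * Num.sqrt (1 - t)))}.
  by apply: cvgN; apply: cvgMr; exact: h2.
exact: (continuous_comp h3 (@continuous_expR R _)).
Qed.

(** Inside the interval this is the tail of the series; the endpoints follow by continuity along
    [(1 - 1 / (j + 1)) * t], because the bound is independent of [t]. *)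
Lemma lap_profile_partial_sum t N : `|t| <= 1 ->
  `|lap_profile t - \sum_(n < N) a n * t ^+ n| <= lap_sum - \sum_(n < N) a n.
Proof.
have interior s : `|s| < 1 ->
    `|lap_profile s - \sum_(n < N) a n * s ^+ n| <= lap_sum - \sum_(n < N) a n.
  move=> s1; rewrite -lap_profile_series//.
  have cv : (fun M => `|\sum_(n < M) a n * s ^+ n - \sum_(n < N) a n * s ^+ n|) @ \oo -->
      `|F s - \sum_(n < N) a n * s ^+ n|.
    apply: cvg_norm; apply: cvgB; last exact: cvg_cst.
    have := is_cvg_lap_pseries s1; rewrite {1}/pseries /series /=.
    rewrite (_ : (fun n => _) = (fun M => \sum_(n < M) a n * s ^+ n))//.
    by apply/funext => M; rewrite big_mkord.
  apply: (ler_cvg_to cv (cvg_cst _)); near=> M.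
  apply: lap_partial_sum_le; first by near: M; exact: nbhs_infty_ge.
  by move=> n; rewrite normrX exprn_ile1// ltW.
move=> t1; pose u j : R := (1 - j.+1%:R^-1) * t.
have ut : u @ \oo --> t.
  have h : (fun j => (1 - j.+1%:R^-1) * t) @ \oo --> (1 - 0) * t.
    by apply: cvgMl; apply: cvgB; [exact: cvg_cst|exact: cvg_harmonic].
  by rewrite subr0 mul1r in h.
have cS : continuous (fun s : R => \sum_(n < N) a n * s ^+ n).
  move=> s; elim: N {interior} => [|M IH].
    rewrite (_ : (fun s => _) = cst 0); last by apply/funext => ?; rewrite big_ord0.
    exact: cvg_cst.
  rewrite (_ : (fun s => _) = (fun s => \sum_(n < M) a n * s ^+ n + a M * s ^+ M)); last first.
    by apply/funext => ?; rewrite big_ord_recr.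
  by apply: cvgD => //; apply: cvgMr; exact: exprn_continuous.
have cv : (fun j => `|lap_profile (u j) - \sum_(n < N) a n * u j ^+ n|) @ \oo -->
    `|lap_profile t - \sum_(n < N) a n * t ^+ n|.
  apply: cvg_norm; apply: cvgB.
    exact: (cvg_comp _ _ ut (@continuous_lap_profile t)).
  exact: (cvg_comp _ _ ut (cS t)).
apply: (ler_cvg_to cv (cvg_cst _)); apply: nearW => j; apply: interior.
have j0 : 0 < j.+1%:R^-1 :> R by rewrite invr_gt0.
have j1 : j.+1%:R^-1 <= 1 :> R by rewrite invf_le1 ?ler1n.
rewrite /u normrM ger0_norm ?subr_ge0//.
apply: (@le_lt_trans _ _ (1 - j.+1%:R^-1)); first by rewrite ler_piMr ?subr_ge0.
by rewrite gtrBl.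
Unshelve. all: end_near. Qed.

End LaplaceKernel.

(** * Eigenfunctions of the kernel and the Mercer expansion *)

Section MercerExpansion.
Variables (R : realType) (d : nat) (c : R).
Hypotheses (d2 : (2 <= d)%N) (c0 : 0 < c).
Implicit Types (x z : 'rV[R]_d).
Local Notation w := (sint (fun _ : 'rV[R]_d => 1 : R)).
Local Notation a := (lap_coef c).
Local Notation tail := (fun N => lap_sum c - \sum_(n < N) a n).

Let d0 : (0 < d)%N. Proof. exact: ltn_trans d2. Qed.
Let w0 : 0 < w. Proof. exact: sint1_gt0. Qed.

Lemma klapE x z : klap c x z = lap_profile c (dotp x z).
Proof. by []. Qed.

Lemma lap_tail_cvg0 : tail @ \oo --> (0 : R).
Proof.
rewrite -[X in _ --> X](subrr (lap_sum c)); apply: cvgB; first exact: cvg_cst.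
exact: lap_sum_cvg.
Qed.

Lemma sphere_fun_klap x : sphere_fun (klap c x).
Proof.
split.
  apply: (@jmeas_comp1 _ _ _ _ (lap_profile c) (fun (_ : unit) v => dotp x (normalize v))).
    by apply: continuous_measurable_fun; exact: continuous_lap_profile.
  by apply: jmeas_sum => i; apply: jmeasM; [exact: jmeas_cst|exact: smeas_coord].
exists 1 => z _; rewrite ger0_norm ?expR_ge0// -expR0 ler_expR oppr_le0.
by rewrite mulr_ge0 ?sqrtr_ge0// ltW.
Qed.

(** The partial sums are polynomial kernels with known eigenvalues and approximate [klap] uniformly
    on the sphere, so integration passes to the limit. *)
Lemma klap_eigenfunction k (p : {mpoly R[d]}) x : harm_homog k p -> on_sphere x ->
  sint (fun z => klap c x z * peval p z) = lap_eig c w d k * peval p x.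
Proof.
move=> Hp sx; have [_ [B pB]] := sphere_fun_peval p.
pose s N := \sum_(n < N) a n * moment w d n k.
have sE N : s N * peval p x =
    sint (peval ((\sum_(n < N) a n *: linform x ^+ n) * p)).
  rewrite [in RHS]mulr_suml sint_peval_sum /s mulr_suml; apply: eq_bigr => n _.
  by rewrite -[a n *: linform x ^+ n * p]scalerAl sint_pevalZ (sint_linformX_harm d2 n sx Hp) mulrA.
have skp : sphere_fun (fun z => klap c x z * peval p z).
  by apply: sphere_funM; [exact: sphere_fun_klap|exact: sphere_fun_peval].
have bound N : `|sint (fun z => klap c x z * peval p z) - s N * peval p x| <= tail N * (B * w).
  rewrite sE -[- sint _]mulN1r -(sintZ (-1) (sphere_fun_peval _)).
  rewrite -sintD//; last by apply: sphere_funZ; exact: sphere_fun_peval.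
  rewrite mulrA; apply: sint_norm_le.
    by apply: sphere_funD => //; apply: sphere_funZ; exact: sphere_fun_peval.
  move=> z sz; rewrite pevalM peval_sum mulN1r -mulrBl normrM ler_pM ?pB//.
  rewrite klapE (eq_bigr (fun n : 'I_N => a n * dotp x z ^+ n)); last first.
    by move=> n _; rewrite pevalZ pevalXn peval_linform.
  by apply: lap_profile_partial_sum => //; exact: dotp_sphere_le1.
have cv1 : (fun N => s N * peval p x) @ \oo --> lap_eig c w d k * peval p x.
  by apply: cvgMl; exact: lap_eig_cvg.
have cv2 : (fun N => s N * peval p x) @ \oo --> sint (fun z => klap c x z * peval p z).
  have t0 : (fun N => tail N * (B * w)) @ \oo --> (0 : R).
    have h : (fun N => tail N * (B * w)) @ \oo --> 0 * (B * w).
      by apply: cvgMl; exact: lap_tail_cvg0.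
    by rewrite mul0r in h.
  apply/cvgrPdist_le => e e0; have /cvgrPdist_le /(_ e e0) := t0.
  apply: filterS => N; rewrite sub0r normrN => h.
  by rewrite (le_trans (bound N))// (le_trans (ler_norm _)).
exact: (cvg_unique (@Rhausdorff R) cv2 cv1).
Qed.

Lemma moment_gt n k : (n < k)%N -> moment w d n k = 0.
Proof.
elim: n k => [|n IH] [|k]//; rewrite ltnS => nk.
by rewrite momentSSE IH ?mulr0.
Qed.

Lemma cvg_sum_ord (f : nat -> nat -> R) (l : nat -> R) M :
  (forall k, f k @ \oo --> l k) -> (fun L => \sum_(k < M) f k L) @ \oo --> \sum_(k < M) l k.
Proof.
move=> fl; elim: M => [|M IH].
  rewrite big_ord0 (_ : (fun L => _) = cst 0); last by apply/funext => ?; rewrite big_ord0.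
  exact: cvg_cst.
rewrite big_ord_recr /= (_ : (fun L => _) = (fun L => \sum_(k < M) f k L + f M L)).
  exact: cvgD.
by apply/funext => ?; rewrite big_ord_recr.
Qed.

Lemma mercer_expansion (N : nat -> nat) (Y : forall k : nat, 'I_(N k) -> {mpoly R[d]}) x z :
  (forall k, sh_onb k (Y k)) -> on_sphere x -> on_sphere z ->
  (fun n : nat => \sum_(k < n)
      lap_eig c w d k * \sum_(j < N k) peval (Y k j) x * peval (Y k j) z)
    @ \oo --> klap c x z.
Proof.
move=> HY sx sz.
pose Z k u v := \sum_(j < N k) peval (Y k j) u * peval (Y k j) v.
(* The part of [(u . v) ^ n] in degrees below [M]; it is the full power once [n < M]. *)
pose T M n u v := \sum_(k < M) moment w d n k * Z k u v.
have Textend M n u v : on_sphere u -> on_sphere v -> (n < M)%N -> T M n u v = dotp u v ^+ n.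
  move=> su sv nM; rewrite (zonal_expansion d2 n HY su sv) /T.
  rewrite -(subnKC nM) big_split_ord /= [X in _ + X]big1 ?addr0// => i _.
  by rewrite moment_gt ?mul0r// leq_addr.
have Zdiag k u : 0 <= Z k u u.
  by rewrite sumr_ge0// => j _; rewrite -expr2 sqr_ge0.
(* On the diagonal all terms are nonnegative, and the complete sum is 1. *)
have Tdiag M n u : on_sphere u -> T M n u u <= 1.
  move=> su; apply: (@le_trans _ _ (T (M + n.+1)%N n u u)).
    rewrite /T big_split_ord /= lerDl sumr_ge0// => i _.
    by rewrite mulr_ge0// moment_ge0.
  by rewrite Textend ?ltn_addl// su expr1n.
(* The arithmetic-mean form of Cauchy-Schwarz is enough, as both diagonal sums are bounded by 1. *)
have Zle k : `|Z k x z| <= (Z k x x + Z k z z) / 2.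
  rewrite ler_pdivlMr// /Z -big_split /=; apply: (@le_trans _ _
    ((\sum_(j < N k) `|peval (Y k j) x * peval (Y k j) z|) * 2)).
    by rewrite ler_wpM2r// ler_norm_sum.
  rewrite mulr_suml; apply: ler_sum => j _.
  move: (peval _ x) (peval _ z) => p q.
  have := sqr_ge0 (`|p| - `|q|); rewrite sqrrB !real_normK ?num_real// normrM !expr2.
  by lra.
have Tle M n : `|T M n x z| <= 1.
  apply: (@le_trans _ _ ((T M n x x + T M n z z) / 2)).
    rewrite /T -big_split /= mulr_suml; apply: le_trans (ler_norm_sum _ _ _) _.
    apply: ler_sum => k _; rewrite normrM ger0_norm ?moment_ge0// -mulrDr -mulrA.
    by rewrite ler_wpM2l ?moment_ge0.
  by have := Tdiag M n x sx; have := Tdiag M n z sz; lra.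
have cvM M : (fun L => \sum_(n < L) a n * T M n x z) @ \oo -->
    \sum_(k < M) lap_eig c w d k * Z k x z.
  rewrite (_ : (fun L => _) = (fun L => \sum_(k < M)
      (\sum_(n < L) a n * moment w d n k) * Z k x z)).
    apply: (@cvg_sum_ord (fun k L => (\sum_(n < L) a n * moment w d n k) * Z k x z)
      (fun k => lap_eig c w d k * Z k x z)) => k.
    by apply: cvgMl; exact: lap_eig_cvg.
  apply/funext => L; under [RHS]eq_bigr do rewrite mulr_suml.
  rewrite exchange_big /=; apply: eq_bigr => n _.
  by rewrite /T mulr_sumr; apply: eq_bigr => k _; rewrite mulrA.
(* By [cvM] the truncated Mercer sum is the series of [a n * T M n x z], whose first [M] terms are
   those of the power series; only the tail remains. *)
have b1 M : `|\sum_(k < M) lap_eig c w d k * Z k x z - \sum_(n < M) a n * dotp x z ^+ n| <= tail M.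
  have SE : \sum_(n < M) a n * dotp x z ^+ n = \sum_(n < M) a n * T M n x z.
    by apply: eq_bigr => n _; rewrite Textend.
  have cv : (fun L => `|\sum_(n < L) a n * T M n x z - \sum_(n < M) a n * T M n x z|) @ \oo -->
     `|\sum_(k < M) lap_eig c w d k * Z k x z - \sum_(n < M) a n * T M n x z|.
    by apply: cvg_norm; apply: cvgB; [exact: cvM|exact: cvg_cst].
  rewrite SE; apply: (ler_cvg_to cv (cvg_cst _)); near=> L.
  have ML : (M <= L)%N by near: L; exact: nbhs_infty_ge.
  exact: (lap_partial_sum_le c0 ML (Tle M)).
have b2 M : `|klap c x z - \sum_(n < M) a n * dotp x z ^+ n| <= tail M.
  by rewrite klapE; apply: lap_profile_partial_sum => //; exact: dotp_sphere_le1.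
have t0 : (fun M => tail M + tail M) @ \oo --> (0 : R).
  have h : (fun M => tail M + tail M) @ \oo --> (0 : R) + 0.
    by apply: cvgD; exact: lap_tail_cvg0.
  by rewrite addr0 in h.
apply/cvgrPdist_le => e e0; have /cvgrPdist_le /(_ e e0) := t0.
apply: filterS => M; rewrite sub0r normrN => h.
apply: le_trans (le_trans (ler_norm _) h).
rewrite -(subrKA (\sum_(n < M) a n * dotp x z ^+ n)).
apply: le_trans (ler_normD _ _) _; apply: lerD; first exact: b2.
by rewrite distrC; exact: b1.
Unshelve. all: end_near. Qed.

End MercerExpansion.

Theorem theorem3 (R : realType) (d : nat) (c : R) :
  (2 <= d)%N -> 0 < c ->
  exists lam : nat -> R,
    (* lam k is the Mercer eigenvalue on the degree-k spherical harmonics *)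
    (forall (k : nat) (p : mpoly.mpoly d R), harm_homog k p ->
       forall x : 'rV[R]_d, on_sphere x ->
         sint (fun z => klap c x z * peval p z) = lam k * peval p x) /\
    (* Mercer expansion, for any choice of orthonormal bases *)
    (forall (N : nat -> nat) (Y : forall k : nat, 'I_(N k) -> mpoly.mpoly d R),
       (forall k, sh_onb k (Y k)) ->
       forall x z : 'rV[R]_d, on_sphere x -> on_sphere z ->
         (fun n : nat => \sum_(k < n)
             lam k * \sum_(j < N k) peval (Y k j) x * peval (Y k j) z)
           @ \oo --> klap c x z) /\
    (forall k : nat, 0 < lam k) /\
    (exists (k0 : nat) (B1 B2 : R), 0 < B1 /\ 0 < B2 /\
       forall k : nat, (k0 < k)%N ->
         B1 * (k%:R ^- d) <= lam k /\ lam k <= B2 * (k%:R ^- d)).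
Proof.
move=> d2 c0; have d0 : (0 < d)%N by exact: ltn_trans d2.
have w0 := sint1_gt0 R d0.
exists (lap_eig c (sint (fun _ : 'rV[R]_d => 1 : R)) d); split.
  by move=> k p Hp x sx; exact: klap_eigenfunction.
split; first by move=> N Y HY x z sx sz; exact: mercer_expansion.
split; first by move=> k; exact: lap_eig_gt0.
have [B1 [B2 [B10 [B20 HB]]]] := lap_eig_bounds c0 w0 d0.
(* The two-sided bound already holds for every positive degree. *)
by exists 0%N, B1, B2.
Qed.
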